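(* Let $s\in\mathbb{N}_+$ and $0<\alpha<1$. Let $f\in C^s[0,1]$ be such that $f(0),f(1),f'(0),f'(1)\in\mathbb{Z}$ and $f^{(i)}(0)=f^{(i)}(1)=0$ for $i=2,\dots,s$. Suppose also that there exists $n_0\in\mathbb{N}_+$, $n_0\ge s$, such that \begin{align*} f\left(\tfrac{k}{n}\right)&\ge f(0)+\tfrac{k}{n}\,f'(0),\quad k=1,\dots,s,\ n\ge n_0,\\ f\left(\tfrac{k}{n}\right)&\ge f(1)-\left(1-\tfrac{k}{n}\right)f'(1),\quad k=n-s,\dots,n-1,\ n\ge n_0. \end{align*} Then \[ \|(\widetilde{B}_n(f))^{(s)}-f^{(s)}\|=O(n^{-\alpha})\ (n\to\infty) \] if and only if \[ \omega_\varphi^2(f^{(s)},h)=O(h^{2\alpha})\quad\text{and}\quad\omega_1(f^{(s)},h)=O(h^{\alpha})\ (h\to0+). \]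
   Context: $\mathbb{N}_+=\{1,2,\dots\}$; $\|\cdot\|$ is the sup-norm on $[0,1]$; $C^s[0,1]$ is the space of real-valued $s$ times continuously differentiable functions on $[0,1]$. For $f\in C[0,1]$, $x\in[0,1]$ and $n\in\mathbb{N}_+$, \[ \widetilde{B}_n(f)(x):=\sum_{k=0}^n \left[f\left(\tfrac{k}{n}\right)\binom{n}{k}\right]x^k(1-x)^{n-k}, \] where $[a]$ is the largest integer less than or equal to the real $a$. Moduli: with $\varphi(x):=\sqrt{x(1-x)}$, for $F\in C[0,1]$ and $t>0$, \[ \omega_\varphi^2(F,t):=\sup_{0<h\le t}\|\bar\Delta^2_{h\varphi}F\|, \] where $\bar\Delta^2_{h\varphi(x)}F(x):=F(x+h\varphi(x))-2F(x)+F(x-h\varphi(x))$ if $x\pm h\varphi(x)\in[0,1]$ and $:=0$ otherwise; and \[ \omega_1(F,t):=\sup_{|x-y|\le t,\ x,y\in[0,1]}|F(x)-F(y)|. \] The constants implicit in the $O$-symbols may depend on $f$. For $s=1$ the condition on $f^{(i)}$, $i=2,\dots,s$, is void. *)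

(* Defs.v *)
From HB Require Import structures.
From mathcomp Require Import all_boot all_order all_algebra.
From mathcomp Require Import all_classical all_reals all_analysis.
Set Implicit Arguments.
Unset Strict Implicit.
Unset Printing Implicit Defensive.
Import Order.TTheory GRing.Theory Num.Theory.
Import numFieldNormedType.Exports.
Local Open Scope classical_set_scope.
Local Open Scope ring_scope.

(* A function on [0, 1] is represented by a total f : R -> R; every definition
   below depends only on the values of f on [0, 1]. *)

Section functions_on_01.
Context {R : realType}.
Implicit Types (f F : R -> R) (x t : R) (n s : nat).

(* Difference quotients with y restricted to [0, 1] and y != x, so that the
   derivatives at 0 and 1 are the one-sided ones. *)
Definition derivable01 f x : Prop :=
  cvg ((f y - f x) / (y - x) @[y --> within `[0, 1] x^']).

Definition derive01 f : R -> R := fun x =>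
  lim ((f y - f x) / (y - x) @[y --> within `[0, 1] x^']).

Definition derive01n s f : R -> R := iter s derive01 f.

Definition C01 s f : Prop :=
  (forall i x, (i < s)%N -> x \in `[0, 1] -> derivable01 (derive01n i f) x) /\
  {within `[0, 1], continuous (derive01n s f)}.

(* Here and in the moduli, sup is the real supremum, which is a default value
   on unbounded sets; the functions considered are continuous on [0, 1], so
   that all these sets are bounded (and nonempty, for t > 0). *)
Definition norm01 F : R := sup [set `|F x| | x in `[0, 1]].

Definition intBernstein n f : R -> R := fun x =>
  \sum_(k < n.+1) (Num.floor (f (k%:R / n%:R) * 'C(n, k)%:R))%:~R
                  * x ^+ k * (1 - x) ^+ (n - k).

Definition phi x : R := Num.sqrt (x * (1 - x)).

Definition symdiff2 F (u : R) x : R :=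
  if (x + u \in `[0, 1]) && (x - u \in `[0, 1])
  then F (x + u) - 2 * F x + F (x - u) else 0.

Definition omega2phi F t : R :=
  sup [set norm01 (fun x => symdiff2 F (h * phi x) x) | h in `]0, t]].

Definition omega1 F t : R :=
  sup [set `|F p.1 - F p.2| | p in
        [set p : R * R | [/\ p.1 \in `[0, 1], p.2 \in `[0, 1]
                           & `|p.1 - p.2| <= t]]].

End functions_on_01.

(* Main.v *)
Require Import Defs.
From HB Require Import structures.
From mathcomp Require Import all_boot all_order all_algebra.
From mathcomp Require Import all_classical all_reals all_analysis.
From mathcomp Require Import zify ring lra.
Import Order.TTheory GRing.Theory Num.Theory.
Import numFieldNormedType.Exports.
Local Open Scope classical_set_scope.
Local Open Scope ring_scope.

(* Let F = f^(s) and let T_n be the integer Bernstein polynomial, with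
   coefficients b_k = [f(k/n) C(n,k)] / C(n,k) in the Bernstein basis.

   For k <= s or k >= n - s the hypotheses force b_k to be the value at k/n of
   the tangent line of f at the end point, so by Taylor's formula f(k/n) - b_k is
   O(n^-s omega_1(F, s/n)); for the other k it is at most 1/C(n,k) = O(n^(-s-1)).
   Hence the Bernstein coefficients of T_n^(s) are, up to
   O(1/n + omega_1(F, s/n)), those of B_n(f)^(s), which by the mean value theorem
   are n(n-1)...(n-s+1) n^-s F(xi_k) with xi_k in [k/n, (k+s)/n].

   Sufficiency: this reduces the claim to |B_N F - F| = O(N^-alpha), N = n - s.
   At x with N x(1-x) <= 1 the Hoelder condition suffices; elsewhere F differs from
   a linear function by O(N^-alpha (1 + (y-x)^2 / d^2)) with
   d = phi(x) / (2 sqrt N), because the midpoint m of x and any y in [0, 1]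
   satisfies phi(m) >= phi(x)/2.

   Necessity: if A_n bounds |T_n^(s+1)| and |phi^2 T_n^(s+2)| on [0, 1], then
   A_n <= C (n |F - T_m^(s)| + A_m + 1), and a Berens-Lorentz iteration along
   n = n_2 B^j gives A_n = O(n^(1-alpha)), hence good smooth approximants to F. *)

(** * Bernstein forms *)

Section Bernstein.
Context {R : realFieldType}.
Implicit Types (c : nat -> R) (x M : R) (N k : nat).

(** After s differentiations an error in a Bernstein coefficient is multiplied by about n^s, while
    for k <= s the rounding error is only bounded by 1/C(n,k), at best of order n^-s: there the
    floor must be known exactly. The tangent line times C(n,k) is an integer, f lies above it by
    hypothesis and, for large n, by less than 1/C(n,k), so the floor returns it.

    The map f -> T_n is not linear, so inverse theorems for linear operators do not apply to it. The
    bound on A_n comes from comparing T_n with the Bernstein polynomial of T_m, for which linear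
    estimates hold. The rounding error then involves omega_1(F, s/n), not yet controlled, which is
    estimated through T_m by 2 |F - T_m^(s)| + A_m s/n. With n = B m the term n |F - T_m^(s)| is
    O(m^(1-alpha)), and the factor C before A_m is absorbed because B^(1-alpha) can exceed it; this
    uses alpha < 1. The first bound in A_n yields omega_1 at scale t = h, the weighted one
    omega_phi^2 at t = h^2. *)

Definition bern N k : {poly R} :=
  'C(N, k)%:R *: ('X^k * (1 - 'X) ^+ (N - k)).

Definition bform N c : {poly R} := \sum_(k < N.+1) c k *: bern N k.

Definition fdiff c k := c k.+1 - c k.

Lemma sum_bern N : \sum_(k < N.+1) bern N k = 1.
Proof.
transitivity (((1 - 'X) + 'X : {poly R}) ^+ N); last by rewrite subrK expr1n.
rewrite exprDn; apply: eq_bigr => k _.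
by rewrite /bern scaler_nat mulrC.
Qed.

Lemma bernE N k x : (bern N k).[x] = 'C(N, k)%:R * (x ^+ k * (1 - x) ^+ (N - k)).
Proof. by rewrite /bern !hornerE. Qed.

Lemma bern_ge0 N k x : 0 <= x <= 1 -> 0 <= (bern N k).[x].
Proof.
move=> /andP[x0 x1]; rewrite bernE mulr_ge0// mulr_ge0// exprn_ge0//.
by rewrite subr_ge0.
Qed.

Lemma sum_bern1 N x : \sum_(k < N.+1) (bern N k).[x] = 1.
Proof. by rewrite -horner_sum sum_bern hornerE. Qed.

Lemma bformE N c x : (bform N c).[x] = \sum_(k < N.+1) c k * (bern N k).[x].
Proof. by rewrite horner_sum; apply: eq_bigr => k _; rewrite hornerE. Qed.

Lemma bform_cst N M x : (bform N (fun=> M)).[x] = M.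
Proof. by rewrite bformE -mulr_sumr sum_bern1 mulr1. Qed.

Lemma bform_norm_le N c d x : 0 <= x <= 1 ->
  (forall k, (k <= N)%N -> `|c k| <= d k) ->
  `|(bform N c).[x]| <= (bform N d).[x].
Proof.
move=> x01 h; rewrite !bformE (le_trans (ler_norm_sum _ _ _))//.
apply: ler_sum => k _; rewrite normrM [X in _ * X]ger0_norm ?bern_ge0//.
by apply: ler_wpM2r; [exact: bern_ge0|apply: h; rewrite -ltnS].
Qed.

Lemma bform_bound N c M x : 0 <= x <= 1 ->
  (forall k, (k <= N)%N -> `|c k| <= M) -> `|(bform N c).[x]| <= M.
Proof. by move=> x01 /(bform_norm_le _ _ (fun=> M) x x01); rewrite bform_cst. Qed.

Lemma bformB N c d : bform N c - bform N d = bform N (fun k => c k - d k).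
Proof. by rewrite -sumrB; apply: eq_bigr => k _; rewrite scalerBl. Qed.

Lemma bformD N c d : bform N c + bform N d = bform N (fun k => c k + d k).
Proof. by rewrite -big_split; apply: eq_bigr => k _; rewrite scalerDl. Qed.

Lemma bformZ N (a : R) c : a *: bform N c = bform N (fun k => a * c k).
Proof. by rewrite scaler_sumr; apply: eq_bigr => k _; rewrite scalerA. Qed.

Lemma eq_bform N c d : (forall k, (k <= N)%N -> c k = d k) ->
  bform N c = bform N d.
Proof. by move=> h; apply: eq_bigr => k _; rewrite h// -ltnS. Qed.

Lemma deriv1X N : ((1 - 'X) ^+ N : {poly R})^`() = - N%:R *: (1 - 'X) ^+ N.-1.
Proof.
rewrite deriv_exp derivB derivX -[1]/(1%:P) derivC sub0r mulN1r.
by rewrite scaleNr scaler_nat mulNrn.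
Qed.

Lemma bern_small N k : (N < k)%N -> bern N k = 0.
Proof. by move=> h; rewrite /bern bin_small// scale0r. Qed.

Lemma deriv_bern0 N : (bern N.+1 0)^`() = - N.+1%:R *: bern N 0.
Proof. by rewrite /bern !bin0 !scale1r !expr0 !mul1r !subn0 deriv1X. Qed.

Lemma deriv_bernS N k :
  (bern N.+1 k.+1)^`() = N.+1%:R *: (bern N k - bern N k.+1).
Proof.
have lin (p k' m n p1 p2 : nat) (A B : {poly R}) :
    (p * k' = n * p1)%N -> (p * m = n * p2)%N ->
    p%:R *: (A *+ k' + (- m%:R) *: B) = n%:R *: (p1%:R *: A - p2%:R *: B).
  move=> h1 h2; rewrite scaleNr -[A *+ k']scaler_nat !scalerBr !scalerA.
  by rewrite -!natrM h1 h2.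
rewrite /bern derivZ derivM derivXn deriv1X subSS /= subnS mulrnAl -scalerAr.
apply: lin; first by rewrite mulnC -mul_bin_diag.
by have := mul_bin_down N.+1 k.+1; rewrite subSS /= => ->; rewrite mulnC.
Qed.

Lemma deriv_bform N c :
  (bform N.+1 c)^`() = N.+1%:R *: bform N (fdiff c).
Proof.
rewrite /bform big_ord_recl derivD derivZ deriv_bern0 raddf_sum /=.
transitivity (N.+1%:R *: (- (c 0%N *: bern N 0) +
   \sum_(k < N.+1) (c k.+1 *: bern N k - c k.+1 *: bern N k.+1))).
  rewrite scalerDr scaler_sumr; congr (_ + _).
    by rewrite scaleNr !scalerN !scalerA [c 0%N * _]mulrC.
  apply: eq_bigr => k _; rewrite /bump /= add1n derivZ deriv_bernS.
  by rewrite -scalerBr !scalerA [_ * c _]mulrC.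
congr (_ *: _).
rewrite sumrB addrCA -opprD.
have -> : c 0%N *: bern N 0 + \sum_(k < N.+1) c k.+1 *: bern N k.+1
   = \sum_(k < N.+1) c k *: bern N k.
  transitivity (\sum_(k < N.+2) c k *: bern N k).
    by rewrite [RHS]big_ord_recl.
  by rewrite big_ord_recr /= bern_small// scaler0 addr0.
by rewrite -sumrB; apply: eq_bigr => k _; rewrite -scalerBl.
Qed.

Lemma deriv_bform0 c : (bform 0 c)^`() = 0.
Proof.
rewrite /bform big_ord1 /bern bin0 !expr0 mulr1 scale1r derivZ.
by rewrite -[1]/(1%:P) derivC scaler0.
Qed.

Lemma derivn_bform N s c :
  (bform (N + s) c)^`(s) = ((N + s) ^_ s)%:R *: bform N (iter s fdiff c).
Proof.
elim: s c => [|s ih] c; first by rewrite addn0 derivn0 ffactn0 scale1r.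
rewrite addnS derivSn deriv_bform derivnZ ih scalerA -natrM.
by rewrite ffactSS -iterSr.
Qed.

(** The weight x(1-x) is absorbed by raising the degree by two, so a weighted second derivative is
    again a Bernstein form, with the discrete weight (k+1)(N+1-k) on its coefficients. *)
Lemma phi2_bern N k : (k <= N)%N ->
  (N.+2 ^_ 2)%:R *: ('X * (1 - 'X) * bern N k) =
  (k.+1 * (N.+1 - k))%:R *: bern N.+2 k.+1.
Proof.
move=> kN; rewrite /bern -scalerAr !scalerA -!natrM.
have -> : ('X * (1 - 'X) * ('X^k * (1 - 'X) ^+ (N - k)) : {poly R}) =
   'X^(k.+1) * (1 - 'X) ^+ (N.+2 - k.+1).
  by rewrite subSS subSn// !exprS; ring.
congr (_%:R *: _).
have h1 := mul_bin_diag N.+2 k; have h2 := mul_bin_down N.+1 k.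
move: h1 h2 => /=; rewrite ffactnSr ffactn1; nia.
Qed.

Lemma phi2_deriv2_bform N c :
  'X * (1 - 'X) * (bform N.+2 c)^`(2) =
  \sum_(k < N.+1) ((k.+1 * (N.+1 - k))%:R * fdiff (fdiff c) k) *: bern N.+2 k.+1.
Proof.
rewrite -(addn2 N) derivn_bform addn2 /= -scalerAr /bform [in LHS]mulr_sumr.
rewrite scaler_sumr; apply: eq_bigr => k _.
rewrite -[in LHS]scalerAr scalerA [in LHS]mulrC -[LHS]scalerA phi2_bern.
  by rewrite scalerA mulrC.
by rewrite -ltnS.
Qed.

Lemma fdiff_bound c M N : (forall k, (k <= N.+1)%N -> `|c k| <= M) ->
  forall k, (k <= N)%N -> `|fdiff c k| <= 2 * M.
Proof.
move=> h k kN; rewrite /fdiff (le_trans (ler_normB _ _))// mulrDl mul1r.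
by apply: lerD; apply: h; lia.
Qed.

Lemma iter_fdiff_bound c M s N : (forall k, (k <= N + s)%N -> `|c k| <= M) ->
  forall k, (k <= N)%N -> `|iter s fdiff c k| <= 2 ^+ s * M.
Proof.
elim: s N => [|s ih] N h k kN; first by rewrite mul1r h// addn0.
rewrite exprS -mulrA; apply: (fdiff_bound _ _ N) => // j jN.
by apply: (ih N.+1) => // i iN; apply: h; lia.
Qed.

Lemma deriv_bform_bound N c M x : 0 <= x <= 1 ->
  (forall k, (k <= N)%N -> `|c k| <= M) ->
  `|(bform N c)^`().[x]| <= 2 * N%:R * M.
Proof.
case: N => [|N] x01 h.
  by rewrite deriv_bform0 horner0 normr0 mulr0 mul0r.
rewrite deriv_bform hornerZ normrM ger0_norm// -mulrA mulrCA ler_wpM2l//.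
by apply: bform_bound => // k kN; exact: (fdiff_bound _ _ N).
Qed.

Lemma phi2_le x : 0 <= x <= 1 -> 0 <= x * (1 - x) <= 1.
Proof. by nra. Qed.

(** Logarithmic differentiation, multiplied out to avoid dividing by x(1-x). The moments and the
    second derivative below all come from it. *)
Lemma phi2_deriv_bern N k :
  (k <= N)%N -> 'X * (1 - 'X) * (bern N k)^`() = (k%:R%:P - N%:R *: 'X) * bern N k.
Proof.
move=> kN; rewrite /bern derivZ derivM derivXn deriv1X -!scalerAr.
congr (_ *: _); rewrite mulrDr.
have -> : ('X * (1 - 'X) * (('X^(k.-1) *+ k) * (1 - 'X) ^+ (N - k)) : {poly R}) =
   k%:R *: ((1 - 'X) * ('X^k * (1 - 'X) ^+ (N - k))).
  case: k {kN} => [|k]; first by rewrite mulr0n scale0r mul0r mulr0.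
  by rewrite exprS -scaler_nat -!mul_polyC /=; ring.
have -> : ('X * (1 - 'X) * (- (N - k)%:R *: ('X^k * (1 - 'X) ^+ (N - k).-1)) : {poly R}) =
   - (N - k)%:R *: ('X * ('X^k * (1 - 'X) ^+ (N - k))).
  case: (N - k)%N => [|m]; first by rewrite oppr0 !scale0r !mulr0.
  by rewrite exprS -!mul_polyC /=; ring.
by rewrite natrB// -!mul_polyC !(polyCN, polyCD); ring.
Qed.

Lemma phi4_deriv2_bern N k x : (k <= N)%N ->
  (x * (1 - x)) ^+ 2 * (bern N k)^`(2).[x] =
  ((k%:R - N%:R * x) ^+ 2 - N%:R * (x * (1 - x)) - (1 - 2 * x) * (k%:R - N%:R * x))
    * (bern N k).[x].
Proof.
move=> kN; have h := phi2_deriv_bern N k kN.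
have h1 := congr1 (fun p => p.[x]) h.
have h2 := congr1 (fun p => p^`().[x]) h.
rewrite derivnS derivn1; move: h1 h2; move: (bern N k) => b {h}.
move=> h1; rewrite !derivM !derivB derivC !derivZ derivX -[1]/(1%:P) derivC => h2.
rewrite !hornerE in h1 h2.
rewrite expr2 -mulrA.
have -> : x * (1 - x) * b^`()^`().[x] =
   - N%:R * b.[x] + (k%:R - N%:R * x) * b^`().[x] - (1 - 2 * x) * b^`().[x].
  by move: h2; lra.
rewrite [LHS](_ : _ = - N%:R * (x * (1 - x)) * b.[x] +
   (k%:R - N%:R * x - (1 - 2 * x)) * (x * (1 - x) * b^`().[x])); last by ring.
by rewrite h1; ring.
Qed.

Lemma sum_dev_bern N :
  \sum_(k < N.+1) (k%:R%:P - N%:R *: 'X) * bern N k = 0 :> {poly R}.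
Proof.
transitivity ('X * (1 - 'X) * (\sum_(k < N.+1) bern N k)^`()).
  rewrite raddf_sum mulr_sumr; apply: eq_bigr => k _.
  by rewrite phi2_deriv_bern// -ltnS.
by rewrite sum_bern -[1]/(1%:P) derivC mulr0.
Qed.

Lemma bern_moment1 N x :
  \sum_(k < N.+1) (k%:R - N%:R * x) * (bern N k).[x] = 0.
Proof.
have := congr1 (fun p => p.[x]) (sum_dev_bern N).
rewrite horner0 horner_sum => {2}<-; apply: eq_bigr => k _.
by rewrite !hornerM !hornerE.
Qed.

(** Differentiate [sum_dev_bern] and multiply by x(1-x): each derivative of a Bernstein polynomial
    contributes another factor k - Nx. *)
Lemma bern_moment2 N x :
  \sum_(k < N.+1) (k%:R - N%:R * x) ^+ 2 * (bern N k).[x] = N%:R * (x * (1 - x)).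
Proof.
have := congr1 (fun p => x * (1 - x) * p^`().[x]) (sum_dev_bern N).
rewrite deriv0 horner0 mulr0 raddf_sum horner_sum mulr_sumr /=.
have e (k : 'I_N.+1) : x * (1 - x) * ((k%:R%:P - N%:R *: 'X) * bern N k)^`().[x]
   = (k%:R - N%:R * x) ^+ 2 * (bern N k).[x] - N%:R * (x * (1 - x)) * (bern N k).[x].
  have kN : (k <= N)%N by rewrite -ltnS.
  have := congr1 (fun p => p.[x]) (phi2_deriv_bern N k kN).
  move: (bern N k) => b.
  move=> h1; rewrite !hornerE in h1.
  have -> : ((k%:R%:P - N%:R *: 'X) * b)^`().[x] =
      - N%:R * b.[x] + (k%:R - N%:R * x) * b^`().[x].
    by rewrite derivM !derivB derivC derivZ derivX !hornerE; ring.
  by rewrite mulrDr [X in _ + X]mulrCA h1; ring.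
under eq_bigr do rewrite e.
rewrite sumrB -mulr_sumr sum_bern1 mulr1.
by move/eqP; rewrite subr_eq0 => /eqP.
Qed.

(** When N x(1-x) <= 1 the crude bound 4 N^2 M on the second derivative is enough. Otherwise
    [phi4_deriv2_bern] is averaged with the second moment, and one factor x(1-x) is cancelled. *)
Lemma phi2_deriv2_bform_bound N c M x : 0 <= x <= 1 ->
  (forall k, (k <= N)%N -> `|c k| <= M) ->
  `|x * (1 - x) * (bform N c)^`(2).[x]| <= 4 * N%:R * M.
Proof.
move=> x01 h.
have M0 : 0 <= M by rewrite (le_trans _ (h 0%N _)).
have /andP[p0 p1] := phi2_le x x01.
set p := x * (1 - x) in p0 p1 *.
have [pN|pN] := leP (p * N%:R) 1.
  have : `|(bform N c)^`(2).[x]| <= 2 * N%:R * (2 * N%:R * M).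
    rewrite derivnS derivn1.
    case: N h {pN} => [|N] h.
      by rewrite deriv_bform0 deriv0 horner0 normr0; nra.
    rewrite deriv_bform derivZ hornerZ normrM ger0_norm//.
    rewrite [X in _ <= X](_ : _ = N.+1%:R * (2 * N.+1%:R * (2 * M))); last by ring.
    rewrite ler_wpM2l//.
    apply: le_trans (deriv_bform_bound N (fdiff c) (2 * M) x x01 _) _.
      exact: fdiff_bound.
    rewrite -!mulrA ler_wpM2l// ler_wpM2r ?mulr_ge0// ler_nat//.
  move=> h2; rewrite normrM (ger0_norm p0).
  apply: le_trans (ler_wpM2l p0 h2) _.
  have : 0 <= N%:R * M by rewrite mulr_ge0.
  nra.
have p_gt0 : 0 < p.
  rewrite lt_neqAle p0 andbT; apply/eqP => p00.
  by move: pN; rewrite -p00 mul0r ltr10.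
suff : p * `|p * (bform N c)^`(2).[x]| <= p * (4 * N%:R * M) by rewrite ler_pM2l.
(* The last summand comes from |(1 - 2x) t| <= (1 + t^2)/2 with t = k - Nx, whose mean square is N
   p. Since N p > 1, the bracket is at most 4 N p. *)
have : p * `|p * (bform N c)^`(2).[x]| <= M * (2 * N%:R * p + 2^-1 * (1 + N%:R * p)).
  rewrite -{1}(ger0_norm p0) -normrM mulrA -expr2.
  have -> : p ^+ 2 * (bform N c)^`(2).[x] =
     \sum_(k < N.+1) c k * (((k%:R - N%:R * x) ^+ 2 - N%:R * p -
        (1 - 2 * x) * (k%:R - N%:R * x)) * (bern N k).[x]).
    rewrite /bform raddf_sum horner_sum mulr_sumr; apply: eq_bigr => k _.
    rewrite -[_ (c k *: _)]/((c k *: bern N k)^`(2)) derivnZ hornerZ mulrCA.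
    by rewrite phi4_deriv2_bern// -ltnS.
  have -> : M * (2 * N%:R * p + 2^-1 * (1 + N%:R * p)) =
    \sum_(k < N.+1) M * (((k%:R - N%:R * x) ^+ 2 * (bern N k).[x] + N%:R * p * (bern N k).[x])
     + 2^-1 * ((bern N k).[x] + (k%:R - N%:R * x) ^+ 2 * (bern N k).[x])).
    rewrite -mulr_sumr; congr (_ * _).
    rewrite big_split /= -mulr_sumr !big_split /= -!mulr_sumr.
    by rewrite sum_bern1 bern_moment2 -/p; ring.
  apply: le_trans (ler_norm_sum _ _ _) _; apply: ler_sum => k _.
  rewrite normrM; apply: ler_pM => //; first by apply: h; rewrite -ltnS.
  rewrite normrM (ger0_norm (bern_ge0 _ _ _ x01)).
  set t := k%:R - N%:R * x; set b := (bern N k).[x].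
  rewrite [X in _ <= X](_ : _ = (t ^+ 2 + N%:R * p + 2^-1 * (1 + t ^+ 2)) * b);
    last by ring.
  rewrite ler_wpM2r ?bern_ge0//.
  have Np : 0 <= N%:R * p by rewrite mulr_ge0.
  move: x01 => /andP[x0 x1].
  have w1 : (1 - 2 * x) ^+ 2 <= 1 by nra.
  have := sqr_ge0 (t - (1 - 2 * x)); have := sqr_ge0 (t + (1 - 2 * x)).
  by rewrite ler_norml => ? ?; apply/andP; split; nra.
move=> /le_trans; apply.
have : 0 <= M * (N%:R * p - 1) by rewrite mulr_ge0// subr_ge0 mulrC ltW.
nra.
Qed.

End Bernstein.

(** * One-sided derivatives and the mean value theorem *)

Section Calculus.
Context {R : realType}.
Implicit Types (a b x y h : R) (f g : R -> R) (p : {poly R}).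

(* f has derivative g on [a, b], one-sided at the end points. *)
Definition difI a b f g := forall x, a <= x <= b -> forall e, 0 < e ->
  exists2 d, 0 < d & forall y, a <= y <= b -> `|y - x| < d ->
    `|f y - f x - g x * (y - x)| <= e * `|y - x|.

Lemma difI_sub a b a' b' f g : a <= a' -> b' <= b -> difI a b f g -> difI a' b' f g.
Proof.
move=> aa bb df x /andP[ax xb] e e0.
have [|d d0 dP] := df x _ e e0; first by lra.
by exists d => // y /andP[ay yb] yx; apply: dP => //; lra.
Qed.

Lemma difIB a b f1 g1 f2 g2 : difI a b f1 g1 -> difI a b f2 g2 ->
  difI a b (fun x => f1 x - f2 x) (fun x => g1 x - g2 x).
Proof.
move=> df1 df2 x xab e e0; have e20 : 0 < e / 2 by lra.
have [d1 d10 h1] := df1 x xab _ e20; have [d2 d20 h2] := df2 x xab _ e20.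
exists (Num.min d1 d2) => [|y yab]; first by rewrite lt_min d10.
rewrite lt_min => /andP[y1 y2].
rewrite [X in `|X|](_ : _ = (f1 y - f1 x - g1 x * (y - x)) -
  (f2 y - f2 x - g2 x * (y - x))); last by ring.
apply: le_trans (ler_normB _ _) _.
by have := h1 _ yab y1; have := h2 _ yab y2; lra.
Qed.

Lemma difI_shift a b f g h : difI a b f g ->
  difI (a - h) (b - h) (fun x => f (x + h)) (fun x => g (x + h)).
Proof.
move=> df x xab e e0; have [|d d0 dP] := df (x + h) _ e e0; first by lra.
exists d => // y yab yx; have := dP (y + h).
by rewrite (_ : y + h - (x + h) = y - x); [apply; lra|ring].
Qed.

Lemma eq_difI a b f1 g1 f2 g2 : (forall x, a <= x <= b -> f1 x = f2 x) ->
  (forall x, a <= x <= b -> g1 x = g2 x) -> difI a b f1 g1 -> difI a b f2 g2.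
Proof.
move=> ef eg df x xab e e0; have [d d0 dP] := df x xab e e0.
by exists d => // y yab; rewrite -!ef// -eg//; exact: dP.
Qed.

Lemma difI_is_derive a b f g x : difI a b f g -> a < x < b -> is_derive x 1 f (g x).
Proof.
move=> df /andP[ax xb].
suff H : (fun h => h^-1 *: (f (h *: 1 + x) - f x)) @ (0 : R)^' --> g x.
  by apply: DeriveDef; [apply/cvg_ex; exists (g x)|exact/cvg_lim].
apply/cvgrPdist_le => e e0.
have [|d d0 dP] := df x _ e e0; first by lra.
near=> h.
have h0 : h != 0 by near: h; exact: nbhs_dnbhs_neq.
have hd : `|h| < Num.min d (Num.min (x - a) (b - x)).
  near: h; apply: dnbhs0_lt; rewrite !lt_min; lra.
move: hd; rewrite !lt_min => /and3P[hd].
rewrite !ltr_norml => /andP[h1 h2] /andP[h3 h4].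
have := dP (h + x); rewrite addrK => /(_ _ hd); rewrite [h *: 1]mulr1.
rewrite [h^-1 *: _]mulrC => /(_ ltac:(lra)) H.
have h0' : 0 < `|h| by rewrite normr_gt0.
rewrite -(ler_pM2r h0') -normrM mulrBl divfK//.
by rewrite distrC.
Unshelve. all: by end_near. Qed.

Lemma difI_continuous a b f g : difI a b f g -> {within `[a, b], continuous f}.
Proof.
move=> df; apply/subspace_continuousP => x; rewrite /= in_itv /= => xab.
apply/cvgrPdist_le => e e0; rewrite near_withinE.
have [d d0 dP] := df x xab 1 ltr01.
have g0 : 0 < 1 + `|g x| by rewrite ltr_pwDl.
near=> y; rewrite /= in_itv /= => yab.
have : `|y - x| < Num.min d (e / (1 + `|g x|)).
  near: y; rewrite !near_simpl; apply/nbhs_normP.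
  exists (Num.min d (e / (1 + `|g x|))) => /=; first by rewrite lt_min d0 divr_gt0.
  by move=> y /=; rewrite distrC.
rewrite lt_min ltr_pdivlMr// => /andP[yd ye].
have H := dP y yab yd.
have := ler_normD (f y - f x - g x * (y - x)) (g x * (y - x)).
rewrite subrK normrM distrC; lra.
Unshelve. all: by end_near. Qed.

Lemma difI_MVT a b f g x y : difI a b f g -> a <= x -> x <= y -> y <= b ->
  exists2 c, x <= c <= y & f y - f x = g c * (y - x).
Proof.
move=> df ax xy yb.
have [||c] := @MVT_segment R f g x y xy.
- move=> z; rewrite in_itv /= => /andP[xz zy].
  by apply: (difI_is_derive _ _ _ _ _ df); lra.
- by apply: difI_continuous; apply: difI_sub df.
by rewrite in_itv /= => cxy ->; exists c.
Qed.

Lemma difI_horner a b p : difI a b (horner p) (horner p^`()).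
Proof.
move=> x _ e e0.
have /cvgrPdist_le/(_ e e0) : (fun h => h^-1 *: (p.[h *: 1 + x] - p.[x])) @ (0 : R)^'
    --> p^`().[x].
  have [] := is_derive_poly p x; rewrite /derivable /derive => + <-.
  by move=> /cvg_ex[l hl]; rewrite (cvg_lim _ hl).
move=> /nbhs_normP[d /= d0 dP]; exists d => // y _ yx.
have [->|xy] := eqVneq y x; first by rewrite !subrr mulr0 subr0 normr0 mulr0.
have yx0 : y - x != 0 by rewrite subr_eq0.
have := dP (y - x); rewrite /= sub0r normrN => /(_ yx yx0).
rewrite [_ *: 1]mulr1 subrK [_ *: _]mulrC => H.
have h0' : 0 < `|y - x| by rewrite normr_gt0.
by move: H; rewrite -(ler_pM2r h0') -normrM mulrBl divfK// distrC.
Qed.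

Lemma derivable01P f x : 0 <= x <= 1 -> derivable01 f x ->
  forall e, 0 < e -> exists2 d, 0 < d & forall y, 0 <= y <= 1 -> `|y - x| < d ->
    `|f y - f x - derive01 f x * (y - x)| <= e * `|y - x|.
Proof.
move=> x01 dfx e e0.
have /cvgrPdist_le/(_ e e0) : (fun y => (f y - f x) / (y - x)) @ within `[0, 1] x^'
    --> derive01 f x by exact: dfx.
rewrite near_withinE => /nbhs_normP[d /= d0 dP]; exists d => // y y01 yx.
have [->|xy] := eqVneq y x; first by rewrite !subrr mulr0 subr0 normr0 mulr0.
have yx0 : y - x != 0 by rewrite subr_eq0.
have := dP y; rewrite /= distrC in_itv /= => /(_ yx xy y01) H.
have h0' : 0 < `|y - x| by rewrite normr_gt0.
by move: H; rewrite -(ler_pM2r h0') -normrM mulrBl divfK// distrC.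
Qed.

(** Needed for the limit in [derive01] to be unique, also at 0 and 1. The witness moves from x
    towards the farther end point, so a step of at most 1/2 stays inside. *)
Lemma within01_proper x : 0 <= x <= 1 -> ProperFilter (within `[0, 1]%classic x^').
Proof.
move=> x01; apply: Build_ProperFilter_ex => P.
rewrite /within /= => /nbhs_normP[d /= d0 dP].
pose t := Num.min (d / 2) (1 / 2).
have t0 : 0 < t by rewrite lt_min; lra.
have [t1 t2] : t < d /\ t <= 1 / 2.
  by split; [rewrite gt_min; lra|rewrite ge_min; lra].
have [xh|xh] := leP x (1 / 2).
- exists (x + t); apply: dP => /=.
  + by rewrite opprD addNKr normrN gtr0_norm.
  + by apply/eqP; lra.
  + by rewrite in_itv /=; lra.
- exists (x - t); apply: dP => /=.
  + by rewrite opprB addrCA subrr addr0 gtr0_norm.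
  + by apply/eqP; lra.
  + by rewrite in_itv /=; lra.
Qed.

Lemma difI_derive01 f g x : difI 0 1 f g -> 0 <= x <= 1 -> derive01 f x = g x.
Proof.
move=> df x01; have := within01_proper x x01 => pf.
apply/cvg_lim => //; apply/cvgrPdist_le => e e0; rewrite near_withinE.
have [d d0 dP] := df x x01 e e0.
apply/nbhs_normP; exists d => //= y /=.
rewrite distrC => yx xy; rewrite in_itv /= => y01.
have yx0 : y - x != 0 by rewrite subr_eq0.
have h0' : 0 < `|y - x| by rewrite normr_gt0.
by rewrite -(ler_pM2r h0') -normrM mulrBl divfK// distrC dP.
Qed.

Lemma C01_difI s f i : C01 s f -> (i < s)%N ->
  difI 0 1 (derive01n i f) (derive01n i.+1 f).
Proof.
move=> [df _] si x x01; apply: derivable01P => //.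
by apply: df => //; rewrite in_itv.
Qed.

Lemma derive01n_horner s p x : 0 <= x <= 1 -> derive01n s (horner p) x = (p^`(s)).[x].
Proof.
elim: s x => [|s ih] x x01; first by rewrite derivn0.
rewrite derivnS [LHS]/=; apply: difI_derive01 => //.
by apply: eq_difI (difI_horner 0 1 p^`(s)) => // y y01; rewrite -ih.
Qed.

Lemma iter_fdiff_MVT s (u : nat -> R -> R) a b x h : 0 <= h ->
  (forall i, (i < s)%N -> difI a b (u i) (u i.+1)) -> a <= x -> x + s%:R * h <= b ->
  exists2 c, x <= c <= x + s%:R * h &
    iter s fdiff (fun k => u 0%N (x + k%:R * h)) 0%N = h ^+ s * u s c.
Proof.
move=> h0; elim: s u b => [|s ih] u b du ax xb.
  by exists x; rewrite /= ?mul0r ?addr0 ?lexx// mul1r.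
have sh : 0 <= s%:R * h by rewrite mulr_ge0.
rewrite -natr1 mulrDl mul1r in xb *.
have [|||c /andP[xc cx] hc] := ih (fun i y => u i (y + h) - u i y) (b - h).
- move=> i si; apply: difIB.
    have := difI_shift _ _ _ _ h (du i (ltnW si)).
    by apply: difI_sub => //; lra.
  by apply: difI_sub (du i (ltnW si)); lra.
- by [].
- lra.
have [|||c' /andP[cc' c'c] uc] := difI_MVT _ _ _ _ c (c + h) (du s (leqnn _)); try lra.
exists c'; first by lra.
rewrite iterSr exprSr -mulrA.
have -> : h * u s.+1 c' = u s (c + h) - u s c by rewrite uc addrC addKr mulrC.
rewrite -hc; congr (iter _ _ _ _); apply/funext => k; rewrite /fdiff.
by rewrite -natr1 mulrDl mul1r addrA.
Qed.

(** Each mean value step from x0 gains one factor r. The factorial of Taylor's formula is given up,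
    as only the order in r matters. *)
Lemma taylor_bound s (u : nat -> R -> R) x0 r W : 0 <= x0 <= 1 -> 
  (forall i, (i < s)%N -> difI 0 1 (u i) (u i.+1)) ->
  (forall i, (i < s)%N -> u i x0 = 0) ->
  (forall z, 0 <= z <= 1 -> `|z - x0| <= r -> `|u s z| <= W) ->
  forall y, 0 <= y <= 1 -> `|y - x0| <= r -> `|u 0%N y| <= W * r ^+ s.
Proof.
move=> x01; elim: s u => [|s ih] u du u0 uW y y01 yr.
  by rewrite mulr1; exact: uW.
have H := ih (fun i => u i.+1) (fun i si => du i.+1 si) (fun i si => u0 i.+1 si) uW.
have [c cx ->] : exists2 c, `|c - x0| <= `|y - x0| /\ 0 <= c <= 1 &
    u 0%N y = u 1%N c * (y - x0).
  have [xy|yx] := leP x0 y.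
    have [|||c cx uc] := difI_MVT _ _ _ _ x0 y (du 0%N isT); try lra.
    exists c; last by rewrite -uc u0// subr0.
    by split; [rewrite !ger0_norm; lra|lra].
  have [|||c cx uc] := difI_MVT _ _ _ _ y x0 (du 0%N isT); try lra.
  exists c; last by move: uc; rewrite u0//; lra.
  by split; [rewrite !ler0_norm; lra|lra].
rewrite normrM exprSr mulrA; apply: ler_pM => //.
by apply: H; [lra|apply: le_trans yr; lra].
Qed.

Lemma symdiff2_poly p (A x u : R) :
  (forall z : R, 0 <= z <= 1 -> `|z * (1 - z) * (p^`(2)).[z]| <= A) ->
  0 <= u -> 0 <= x - u -> x + u <= 1 ->
  x * (1 - x) * `|p.[x + u] - 2 * p.[x] + p.[x - u]| <= 2 * A * u ^+ 2.
Proof.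
move=> pA u0 ux xu.
pose sh (q : {poly R}) (e : R) : {poly R} := q \Po (x%:P + e *: 'X).
have shE q e t : (sh q e).[t] = q.[x + e * t].
  by rewrite horner_comp !hornerE.
have dsh q e : (sh q e)^`() = e *: sh q^`() e.
  rewrite /sh deriv_comp derivD derivC derivZ derivX add0r.
  by rewrite -scalerAr mulr1.
(* This q vanishes at 0, takes the second difference as its value at u, and has derivative
   (u-t)(p''(x+t) + p''(x-t)): Taylor's formula with Cauchy remainder. The factor u-t is what pays
   for the weight. *)
pose q := sh p 1 + sh p (-1) - 2 *: p.[x]%:P
   + (u%:P - 'X) * (sh p^`() 1 - sh p^`() (-1)).
have [|||t /andP[t0 tu]] := difI_MVT 0 u _ _ 0 u (difI_horner 0 u q); rewrite ?lexx//.
have -> : q^`() = (u%:P - 'X) * (sh p^`(2) 1 + sh p^`(2) (-1)).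
  rewrite /q derivnS derivn1 !(derivM, derivB, derivD, derivN, derivZ, derivC, derivX) !dsh.
  rewrite scaler0 !scale1r !scaleN1r; ring.
move=> e; rewrite /q !(hornerE, shE) in e.
rewrite !(mulr0, addr0, subr0, subrr, mul0r, mul1r, mulN1r) in e.
have -> : p.[x + u] - 2 * p.[x] + p.[x - u] =
   u * ((u - t) * ((p^`(2)).[x + t] + (p^`(2)).[x - t])).
  by move: e; lra.
rewrite normrM (ger0_norm u0) normrM [ `|u - t|]ger0_norm ?subr_ge0//.
set K := `|_|.
have -> : x * (1 - x) * (u * ((u - t) * K)) = u * (x * (1 - x) * (u - t) * K).
  by ring.
rewrite [X in _ <= X](_ : _ = u * (u * (2 * A))); last by ring.
apply: ler_wpM2l => //.
(* Concavity of z(1-z): z divides the segment from x to x+u, or x-u, in the ratio t : u-t, and the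
   weight is nonnegative at the far end. *)
have key z : z = x + t \/ z = x - t -> x * (1 - x) * (u - t) <= u * (z * (1 - z)).
  move=> zt.
  have h1 : 0 <= t * (x - u) by rewrite mulr_ge0; lra.
  have h2 : 0 <= t * (1 - x - u) by rewrite mulr_ge0; lra.
  have h3 : 0 <= 1 - x by lra.
  have h4 : 0 <= x by lra.
  have h5 : 0 <= u - t by lra.
  have h6 : 0 <= t * (1 - x - u) * (x + t) by rewrite mulr_ge0//; lra.
  have h7 : 0 <= t * (x - u) * (1 - x + t) by rewrite mulr_ge0//; lra.
  have h8 : 0 <= t * (1 - x) * (u - t) by rewrite !mulr_ge0.
  have h9 : 0 <= t * x * (u - t) by rewrite !mulr_ge0.
  by case: zt => ->; lra.
have b z : z = x + t \/ z = x - t ->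
   x * (1 - x) * (u - t) * `|(p^`(2)).[z]| <= u * A.
  move=> zt; have z01 : 0 <= z <= 1 by case: zt => ->; lra.
  apply: le_trans (ler_wpM2r (normr_ge0 _) (key z zt)) _.
  rewrite -mulrA; apply: ler_wpM2l => //.
  by have := pA z z01; rewrite normrM [X in X * _]ger0_norm//; nra.
have := b _ (or_introl erefl); have := b _ (or_intror erefl).
have := ler_normD (p^`(2)).[x + t] (p^`(2)).[x - t]; rewrite -/K.
have : 0 <= x * (1 - x) * (u - t) by rewrite !mulr_ge0; lra.
nra.
Qed.

End Calculus.

(** * Bernstein approximation under a weighted Zygmund condition *)

Section Direct.
Context {R : realType}.
Implicit Types (a b x y u v M C al : R) (F G : R -> R).

Lemma powR_le1D al x : 0 <= al <= 1 -> 0 <= x -> x `^ al <= 1 + x.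
Proof.
move=> /andP[al0 al1] x0; have [x1|x1] := leP 1 x.
  by rewrite (le_trans (ler1_powR _ _))//; lra.
rewrite (le_trans (_ : _ <= 1 `^ al))//.
  by apply: ge0_ler_powR => //; rewrite ?nnegrE//; lra.
by rewrite powR1; lra.
Qed.

Lemma powRNV x al : 0 <= x -> x `^ (- al) = x^-1 `^ al.
Proof. by move=> x0; rewrite -powR_inv1// -powRrM mulN1r. Qed.

(** Reflect the nearer end point in y: G vanishes there, so 2|G y| is at most M plus the value of
    |G| at the reflected point. Hence the supremum is at most its mean with M; [B] makes it
    finite. *)
Lemma whitney2 a b M (B : R) G :
  (forall y, a <= y <= b -> `|G y| <= B) -> G a = 0 -> G b = 0 ->
  (forall y u, 0 <= u -> a <= y - u -> y + u <= b ->
     `|G (y + u) - 2 * G y + G (y - u)| <= M) ->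
  forall y, a <= y <= b -> `|G y| <= M.
Proof.
move=> GB Ga Gb GM y0 y0ab.
pose A := [set `|G y| | y in [set y | a <= y <= b]].
have Aub y : a <= y <= b -> `|G y| <= sup A.
  move=> yab; apply: ub_le_sup; last by exists y.
  by exists B => _ [z zab <-]; exact: GB.
apply: le_trans (Aub _ y0ab) _.
have : sup A <= (sup A + M) / 2.
  apply: ge_sup; first by exists `|G y0|; exists y0.
  move=> _ [y /= yab <-].
  have [yl|yr] := leP y ((a + b) / 2).
    have := GM y (y - a); rewrite (_ : y - (y - a) = a); last by ring.
    rewrite Ga addr0 => /(_ _ _ _) H.
    have := Aub (y + (y - a)); have := H ltac:(lra) ltac:(lra) ltac:(lra).
    move=> h1 /(_ ltac:(lra)) h2.
    have := ler_normB (G (y + (y - a))) (G (y + (y - a)) - 2 * G y).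
    by rewrite opprB addrC subrK normrM ger0_norm//; lra.
  have := GM y (b - y); rewrite (_ : y + (b - y) = b); last by ring.
  rewrite Gb sub0r => /(_ _ _ _) H.
  have := Aub (y - (b - y)); have := H ltac:(lra) ltac:(lra) ltac:(lra).
  move=> h1 /(_ ltac:(lra)) h2.
  have := ler_normB (G (y - (b - y))) (- (2 * G y) + G (y - (b - y))).
  rewrite (_ : _ - _ = 2 * G y); last by ring.
  by rewrite normrM ger0_norm//; lra.
lra.
Qed.

Lemma bform_sub N (F : R -> R) x :
  (bform N (fun k => F (k%:R / N%:R))).[x] - F x =
  (bform N (fun k => F (k%:R / N%:R) - F x)).[x].
Proof. by rewrite -bformB hornerD hornerN bform_cst. Qed.

Lemma bform_moment2 N x : (0 < N)%N ->
  (bform N (fun k => (k%:R / N%:R - x) ^+ 2)).[x] = x * (1 - x) / N%:R.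
Proof.
move=> N0; have NR : N%:R != 0 :> R by rewrite pnatr_eq0 -lt0n.
have := bern_moment2 N x; rewrite bformE.
have e k : (k%:R - N%:R * x) ^+ 2 * (bern N k).[x] =
    N%:R ^+ 2 * ((k%:R / N%:R - x) ^+ 2 * (bern N k).[x]) by field.
under eq_bigr do rewrite e.
rewrite -mulr_sumr => h; apply: (mulfI (expf_neq0 2 NR)).
by rewrite h; field.
Qed.

Lemma bform_moment1 N x : (0 < N)%N -> (bform N (fun k => k%:R / N%:R - x)).[x] = 0.
Proof.
move=> N0; have NR : N%:R != 0 :> R by rewrite pnatr_eq0 -lt0n.
have := bern_moment1 N x; rewrite bformE.
have e k : (k%:R - N%:R * x) * (bern N k).[x] =
    N%:R * ((k%:R / N%:R - x) * (bern N k).[x]) by field.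
under eq_bigr do rewrite e.
rewrite -mulr_sumr => h; apply: (mulfI NR).
by rewrite h mulr0.
Qed.

Lemma bern_approx_endpoints al C F N x : 0 <= al <= 1 -> 0 <= C -> (0 < N)%N ->
  (forall x y, 0 <= x <= 1 -> 0 <= y <= 1 -> `|F x - F y| <= C * `|x - y| `^ al) ->
  0 <= x <= 1 -> N%:R * (x * (1 - x)) <= 1 ->
  `|(bform N (fun k => F (k%:R / N%:R))).[x] - F x| <= 3 * C * N%:R `^ (- al).
Proof.
move=> al01 C0 N0 hF x01 Np; have NR : 0 < N%:R :> R by rewrite ltr0n.
have NR0 : N%:R != 0 :> R by rewrite gt_eqF.
rewrite bform_sub.
(* From t^al = N^-al (Nt)^al and (Nt)^al <= 1 + Nt <= 2 + (Nt)^2. The second moment turns the square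
   into N x(1-x) <= 1, whence the constant 3. *)
pose d k : R := C * N%:R `^ (- al) * (2 + N%:R ^+ 2 * (k%:R / N%:R - x) ^+ 2).
apply: le_trans (bform_norm_le _ _ d _ x01 _) _; last first.
  rewrite /d -bformZ hornerZ -bformD hornerD bform_cst -bformZ hornerZ.
  rewrite bform_moment2//.
  have -> : N%:R ^+ 2 * (x * (1 - x) / N%:R) = N%:R * (x * (1 - x)) by field.
  have : 0 <= C * N%:R `^ (- al) by rewrite mulr_ge0 ?powR_ge0.
  nra.
move=> k kN; have k01 : 0 <= (k%:R / N%:R : R) <= 1.
  by rewrite divr_ge0//= ler_pdivrMr// mul1r ler_nat.
apply: le_trans (hF _ _ k01 x01) _; rewrite /d -mulrA ler_wpM2l//.
set t := `|_|; have t0 : 0 <= t by exact: normr_ge0.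
have -> : t `^ al = N%:R `^ (- al) * (N%:R * t) `^ al.
  by rewrite (powRM _ (ltW NR) t0) mulrA powRN mulVf ?mul1r// gt_eqF// powR_gt0.
rewrite ler_wpM2l ?powR_ge0//.
apply: le_trans (powR_le1D _ _ al01 _) _; first by rewrite mulr_ge0// ltW.
rewrite -(real_normK (num_real (_ - x))) -/t.
have := sqr_ge0 (N%:R * t - 2^-1); nra.
Qed.

Lemma archi_pow4 x : exists j, x <= 4 ^+ j.
Proof.
have [j xj] : exists j : nat, x <= j%:R.
  by exists (Num.truncn `|x|).+1; rewrite (le_trans (ler_norm _))// ltW// truncnS_gt.
exists j; apply: le_trans xj _.
by rewrite -natrX ler_nat; apply: ltnW; exact: ltn_expl.
Qed.

(* G = F - L, where L interpolates F at x - d and x + d, d = phi(x) / (2 sqrt N). *)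
Lemma bern_approx_interior al C F N x : 0 <= al <= 1 -> 0 <= C -> (0 < N)%N ->
  (exists B : R, forall y, 0 <= y <= 1 -> `|F y| <= B) ->
  (forall y u v, 0 <= v -> 0 <= u -> 0 <= y - u -> y + u <= 1 ->
     u ^+ 2 <= v * (y * (1 - y)) ->
     `|F (y + u) - 2 * F y + F (y - u)| <= C * v `^ al) ->
  0 <= x <= 1 -> 1 < N%:R * (x * (1 - x)) ->
  `|(bform N (fun k => F (k%:R / N%:R))).[x] - F x| <= 50 * C * N%:R `^ (- al).
Proof.
move=> al01 C0 N0 [B FB] hF x01 Np; have NR : 0 < N%:R :> R by rewrite ltr0n.
have NR0 : N%:R != 0 :> R by rewrite gt_eqF.
set p := x * (1 - x) in Np.
have p0 : 0 < p by rewrite -(pmulr_rgt0 _ NR); lra.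
pose d := Num.sqrt (p / (4 * N%:R)).
have d0 : 0 < d by rewrite sqrtr_gt0 divr_gt0// mulr_gt0.
have d2 : d ^+ 2 = p / (4 * N%:R) by rewrite sqr_sqrtr// ltW// divr_gt0// mulr_gt0.
have d2N : 4 * (N%:R * d ^+ 2) = p by rewrite d2; field.
(* This is where N p > 1 is used. It gives z >= x/2 and 1-z >= (1-x)/2 on [x-d, x+d], so the weight
   there is at least p/4. *)
have dp : d <= p / 2.
  have : 0 <= p / 2 by lra.
  move=> p20; rewrite -ler_sqr ?nnegrE//; last exact: ltW.
  have : 0 <= (N%:R * p - 1) * p by rewrite mulr_ge0; lra.
  have : 0 <= N%:R^-1 :> R by rewrite invr_ge0 ltW.
  rewrite d2 => Ni H; have : 0 <= N%:R^-1 * ((N%:R * p - 1) * p) by rewrite mulr_ge0.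
  have -> : N%:R^-1 * ((N%:R * p - 1) * p) = p ^+ 2 - p / N%:R by field.
  have -> : p / (4 * N%:R) = p / N%:R / 4 by field.
  lra.
have dx : d <= x / 2 by rewrite (le_trans dp)// /p; nra.
have dx1 : d <= (1 - x) / 2 by rewrite (le_trans dp)// /p; nra.
pose sl := (F (x + d) - F (x - d)) / (2 * d).
pose G y := F y - (F (x - d) + sl * (y - (x - d))).
pose M := C * N%:R `^ (- al).
have M0 : 0 <= M by rewrite mulr_ge0 ?powR_ge0.
have DG y u : G (y + u) - 2 * G y + G (y - u) = F (y + u) - 2 * F y + F (y - u).
  by rewrite /G; ring.
have G1 y : x - d <= y <= x + d -> `|G y| <= M.
  apply: (whitney2 _ _ _ (B + `|F (x - d)| + `|sl| * (2 * d))).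
  - move=> z zx; rewrite /G (le_trans (ler_normB _ _))// -addrA lerD//.
      by apply: FB; lra.
    rewrite (le_trans (ler_normD _ _))// lerD// normrM ler_wpM2l//.
    by rewrite ger0_norm; lra.
  - by rewrite /G subrr mulr0 addr0 subrr.
  - by rewrite /G /sl; field; rewrite gt_eqF.
  - move=> z u u0 zu uz; rewrite DG.
    rewrite /M (powRNV _ _ (ltW NR)).
    apply: hF => //; [lra|lra|].
    have ud : u <= d by lra.
    have -> : N%:R^-1 * (z * (1 - z)) = (4 * (z * (1 - z))) * (4 * N%:R)^-1 by field.
    apply: (le_trans (_ : _ <= d ^+ 2)); first by rewrite ler_sqr ?nnegrE//; exact: ltW.
    rewrite d2 ler_wpM2r//.
    have h1 : 0 <= (z - x / 2) * (1 - z) by rewrite mulr_ge0; lra.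
    have h2 : 0 <= (1 - z - (1 - x) / 2) * x by rewrite mulr_ge0; lra.
    by rewrite /p; nra.
(* Induction on the dyadic distance from x: G y is the second difference at the midpoint m, minus G
   x, plus 2 G m. With t = (y-x)^2/d^2 >= 1 the constant 12 closes it: (1 + t/4) + 1 + 2(1 + 3t) <=
   1 + 12t. *)
have G2 j y : 0 <= y <= 1 -> (y - x) ^+ 2 <= 4 ^+ j * d ^+ 2 ->
    `|G y| <= M * (1 + 12 * ((y - x) ^+ 2 / d ^+ 2)).
  have dd : 0 < d ^+ 2 by rewrite exprn_gt0.
  have base y' : (y' - x) ^+ 2 <= d ^+ 2 ->
      `|G y'| <= M * (1 + 12 * ((y' - x) ^+ 2 / d ^+ 2)).
    move=> h; have h' : `|y' - x| <= d.
      by rewrite -ler_sqr ?nnegrE ?real_normK ?num_real//; exact: ltW.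
    apply: le_trans (G1 _ _) _; first by move: h'; rewrite ler_norml; lra.
    by rewrite ler_peMr// lerDl mulr_ge0// divr_ge0// ?sqr_ge0// ltW.
  elim: j y => [|j ih] y y01; first by rewrite mul1r => /base.
  move=> yj; have [/base //|yd] := leP ((y - x) ^+ 2) (d ^+ 2).
  pose m := (x + y) / 2.
  have m01 : 0 <= m <= 1 by rewrite /m; lra.
  have mx : (m - x) ^+ 2 = (y - x) ^+ 2 / 4 by rewrite /m; field.
  have : `|G m| <= M * (1 + 12 * ((m - x) ^+ 2 / d ^+ 2)).
    by apply: ih => //; rewrite mx; move: yj; rewrite [4 ^+ j.+1]exprS -mulrA; lra.
  rewrite mx => Gm.
  pose t := (y - x) ^+ 2 / d ^+ 2.
  have t1 : 1 <= t by rewrite ler_pdivlMr// mul1r ltW.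
  have t4 : (y - x) ^+ 2 / 4 / d ^+ 2 = t / 4.
    by rewrite /t; field; rewrite gt_eqF.
  rewrite t4 in Gm.
  rewrite -/t.
  (* The hypothesis on F is used with v = t/(4N): the squared step (y-x)^2/4 equals v p/4, and
     m(1-m) >= p/4. *)
  have D2 : `|G x - 2 * G m + G y| <= M * (1 + t / 4).
    have pm : p / 4 <= m * (1 - m).
      have h1 : 0 <= (m - x / 2) * (1 - m) by rewrite mulr_ge0; rewrite /m; lra.
      have h2 : 0 <= (1 - m - (1 - x) / 2) * x by rewrite mulr_ge0; rewrite /m; lra.
      by rewrite /p; nra.
    have bd : C * (t / (4 * N%:R)) `^ al <= M * (1 + t / 4).
      rewrite /M -mulrA ler_wpM2l// (_ : t / (4 * N%:R) = N%:R^-1 * (t / 4)); last by field.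
      have t40 : 0 <= t / 4 by lra.
      rewrite powRM// ?invr_ge0//.
      by rewrite (powRNV _ _ (ltW NR)) ler_wpM2l ?powR_ge0// powR_le1D//; lra.
    have v0 : 0 <= t / (4 * N%:R) by apply: divr_ge0; lra.
    have key : ((y - x) / 2) ^+ 2 <= t / (4 * N%:R) * (m * (1 - m)).
      apply: le_trans (ler_wpM2l v0 pm).
      have -> : t / (4 * N%:R) * (p / 4) = ((y - x) / 2) ^+ 2; last exact: lexx.
      by rewrite /t -d2N; field; rewrite NR0 gt_eqF.
    apply: le_trans bd.
    have [xy|yx] := leP x y.
      have -> : G x - 2 * G m + G y = F (m + (y - x) / 2) - 2 * F m + F (m - (y - x) / 2).
        have -> : m + (y - x) / 2 = y by rewrite /m; field.
        have -> : m - (y - x) / 2 = x by rewrite /m; field.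
        by rewrite /G /m; field.
      by apply: hF => //; rewrite /m; lra.
    have -> : G x - 2 * G m + G y = F (m + (x - y) / 2) - 2 * F m + F (m - (x - y) / 2).
      have -> : m + (x - y) / 2 = x by rewrite /m; field.
      have -> : m - (x - y) / 2 = y by rewrite /m; field.
      by rewrite /G /m; field.
    apply: hF => //; [by rewrite /m; lra..|].
    by rewrite (_ : ((x - y) / 2) ^+ 2 = ((y - x) / 2) ^+ 2)//; field.
  have Gx : `|G x| <= M by apply: G1; lra.
  have : `|G y| <= `|G x - 2 * G m + G y| + `|G x| + 2 * `|G m|.
    rewrite {1}(_ : G y = (G x - 2 * G m + G y) - G x + 2 * G m); last by ring.
    rewrite (le_trans (ler_normD _ _))// normrM (ger0_norm (_ : 0 <= 2))// lerD2r.
    exact: ler_normB.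
  have : 0 <= M * (t - 1) by rewrite mulr_ge0; lra.
  lra.
have G3 y : 0 <= y <= 1 -> `|G y| <= M * (1 + 12 * ((y - x) ^+ 2 / d ^+ 2)).
  move=> y01; have [j hj] := archi_pow4 ((y - x) ^+ 2 / d ^+ 2).
  by apply: (G2 j) => //; move: hj; rewrite ler_pdivrMr// exprn_gt0.
(* Bernstein forms reproduce linear functions, so F may be replaced by G. *)
have -> : (bform N (fun k => F (k%:R / N%:R))).[x] - F x =
   (bform N (fun k => G (k%:R / N%:R) - G x)).[x].
  rewrite bform_sub -[RHS]addr0 -[in RHS](mulr0 sl) -(bform_moment1 N x N0).
  rewrite -hornerZ bformZ -hornerD bformD; congr (_.[_]).
  by apply: eq_bform => k _; rewrite /G; ring.
(* The 2 collects the constant terms of the bounds on G(k/N) and G(x). The second moment p/N is 4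
   d^2, hence 2 + 12 * 4 = 50. *)
pose dd k : R := M * (2 + 12 * (d ^+ 2)^-1 * (k%:R / N%:R - x) ^+ 2).
apply: le_trans (bform_norm_le _ _ dd _ x01 _) _; last first.
  rewrite /dd -bformZ hornerZ -bformD hornerD bform_cst -bformZ hornerZ.
  rewrite bform_moment2// -/p d2.
  have -> : 2 + 12 * (p / (4 * N%:R))^-1 * (p / N%:R) = 50.
    by field; rewrite NR0 gt_eqF.
  by rewrite /M mulrC mulrA lexx.
move=> k kN; have k01 : 0 <= (k%:R / N%:R : R) <= 1.
  by rewrite divr_ge0//= ler_pdivrMr// mul1r ler_nat.
rewrite (le_trans (ler_normB _ _))//.
have Gx : `|G x| <= M by apply: G1; lra.
by have := G3 _ k01; rewrite /dd; lra.
Qed.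

End Direct.

(** * Finite differences of samples *)

(** Pascal's rule carries the induction, except on the border k + j = n, where symmetry gives
    equality. *)
Lemma leq_bin_mid n j k : (j <= k)%N -> (k + j <= n)%N -> ('C(n, j) <= 'C(n, k))%N.
Proof.
elim: n j k => [|n ih] [|j] [|k] // jk kn; first by rewrite bin0 bin_gt0; lia.
have [kn'|kn'] := leqP (k.+1 + j.+1) n.
  by rewrite !binS; apply: leq_add; apply: ih; lia.
have -> : k.+1 = (n.+1 - j.+1)%N by lia.
by rewrite bin_sub//; lia.
Qed.

Lemma ffact_lb n j : (j <= n)%N -> ((n - j) ^ j <= n ^_ j)%N.
Proof.
elim: j => // j ih jn; rewrite expnSr ffactnSr; apply: leq_mul; last by lia.
apply: leq_trans (ih (ltnW jn)).
by case: j {ih jn} => // j; rewrite leq_exp2r//; lia.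
Qed.

Lemma ffact_ub n j : (n ^_ j <= n ^ j)%N.
Proof. by elim: j => // j ih; rewrite expnSr ffactnSr leq_mul// leq_subr. Qed.

Lemma bin_ub n k : ('C(n, k) <= n ^ k)%N.
Proof.
apply: leq_trans (ffact_ub n k); rewrite -bin_ffact.
by rewrite leq_pmulr// fact_gt0.
Qed.

(** The hypotheses give 2j <= n, so n <= 2(n-j). Taken with j = s+1, it makes the rounding errors of
    the middle coefficients O(n^(-s-1)). *)
Lemma bin_lb_mid n j k : (j <= k)%N -> (k + j <= n)%N ->
  (n ^ j <= 2 ^ j * j`! * 'C(n, k))%N.
Proof.
move=> jk kn; apply: (@leq_trans (2 ^ j * (j`! * 'C(n, j)))%N); last first.
  by rewrite -mulnA leq_mul2l leq_mul2l leq_bin_mid// !orbT.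
rewrite [(j`! * _)%N]mulnC bin_ffact.
apply: (@leq_trans (2 ^ j * (n - j) ^ j)%N); last by rewrite leq_mul2l ffact_lb ?orbT//; lia.
rewrite -expnMn; case: j jk kn => // j jk kn; rewrite leq_exp2r//; lia.
Qed.

Section FiniteDifferences.
Context {R : realType}.
Implicit Types (c d : nat -> R) (x A : R) (p g : {poly R}).

Lemma eq_iter_fdiff s c d : c =1 d -> iter s fdiff c =1 iter s fdiff d.
Proof. by move=> /funext ->. Qed.

Lemma iter_fdiffB s c d k :
  iter s fdiff (fun j => c j - d j) k = iter s fdiff c k - iter s fdiff d k.
Proof. by elim: s k => //= s ih k; rewrite /fdiff !ih; ring. Qed.

Lemma iter_fdiff_shift s c k :
  iter s fdiff c k = iter s fdiff (fun j => c (k + j)%N) 0%N.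
Proof.
elim: s c k => [|s ih] c k; first by rewrite /= addn0.
rewrite !iterSr ih; apply: eq_iter_fdiff => j.
by rewrite /fdiff addnS.
Qed.

Lemma iter_fdiff_node s (u : nat -> R -> R) n k : (0 < n)%N -> (k + s <= n)%N ->
  (forall i, (i < s)%N -> difI 0 1 (u i) (u i.+1)) ->
  exists2 c, k%:R / n%:R <= c <= (k + s)%:R / n%:R &
    iter s fdiff (fun j => u 0%N (j%:R / n%:R)) k = n%:R^-1 ^+ s * u s c.
Proof.
move=> n0 kn du; have nR : 0 < n%:R :> R by rewrite ltr0n.
have [|||c ckn hc] := iter_fdiff_MVT s u 0 1 (k%:R / n%:R) (n%:R^-1) _ du.
- by rewrite invr_ge0.
- by rewrite divr_ge0.
- by rewrite -mulrDl -natrD ler_pdivrMr// mul1r ler_nat.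
exists c; first by rewrite natrD mulrDl.
rewrite -hc iter_fdiff_shift; apply: eq_iter_fdiff => j.
by rewrite natrD mulrDl.
Qed.

Lemma derivn_compXD s p (h : R) : (p \Po ('X + h%:P))^`(s) = p^`(s) \Po ('X + h%:P).
Proof.
elim: s => [|s ih]; first by rewrite !derivn0.
by rewrite !derivnS ih deriv_comp derivD derivX derivC addr0 mulr1.
Qed.

(** The form is the s-th derivative of the Bernstein polynomial of g of degree n = N + s. One more
    derivative produces differences of order s+1, and their factor n^(-s-1) outweighs the falling
    factorials. *)
Lemma deriv_bform_poly_bound s N g A x : (0 < N + s)%N -> 0 <= x <= 1 ->
  (forall z, 0 <= z <= 1 -> `|(g^`(s.+1)).[z]| <= A) ->
  `|(bform N (fun k => ((N + s) ^_ s)%:R *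
      iter s fdiff (fun j => g.[j%:R / (N + s)%:R]) k))^`().[x]| <= A.
Proof.
move=> n0 x01 gA; set n := (N + s)%N in n0 *.
have A0 : 0 <= A by apply: le_trans (gA 0 _) => //; lra.
have nR : 0 < n%:R :> R by rewrite ltr0n.
rewrite -bformZ derivZ hornerZ normrM ger0_norm//.
case: N => [|N] in n n0 nR *.
  by rewrite deriv_bform0 horner0 normr0 mulr0.
rewrite deriv_bform hornerZ normrM ger0_norm//.
have H : `|(bform N (fdiff (iter s fdiff (fun j => g.[j%:R / n%:R])))).[x]| <=
    n%:R^-1 ^+ s.+1 * A.
  apply: bform_bound => // k kN.
  have [|i _|c ck] := iter_fdiff_node s.+1 (fun i => horner (g^`(i))) n k n0.
  - by rewrite /n; lia.
  - by rewrite derivnS; exact: difI_horner.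
  rewrite derivn0 => e; rewrite [X in `|X|]e.
  rewrite normrM ger0_norm ?exprn_ge0 ?invr_ge0// ler_wpM2l// ?exprn_ge0 ?invr_ge0//.
  apply: gA; have : (k + s.+1)%:R / n%:R <= 1 :> R.
    by rewrite ler_pdivrMr// mul1r ler_nat /n; lia.
  have : 0 <= k%:R / n%:R :> R by rewrite divr_ge0.
  lra.
apply: (le_trans (_ : _ <= (n ^ s)%:R * (n%:R * (n%:R^-1 ^+ s.+1 * A)))); last first.
  by rewrite natrX exprS -!mulrA mulVKf ?gt_eqF// mulrA -exprMn divff ?gt_eqF// expr1n mul1r.
rewrite ler_pM ?mulr_ge0// ?ler_nat ?ffact_ub// ler_pM// ler_nat /n; lia.
Qed.

(** The weighted analogue: g^(s+2) is controlled only with its weight, so the mean value theorem is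
    spent on s of the s+2 differences and [symdiff2_poly] handles the remaining two. *)
Lemma phi2_bform_poly_bound s N g A x : (0 < N + s)%N -> 0 <= x <= 1 ->
  (forall z, 0 <= z <= 1 -> `|z * (1 - z) * (g^`(s.+2)).[z]| <= A) ->
  `|x * (1 - x) * (bform N (fun k => ((N + s) ^_ s)%:R *
      iter s fdiff (fun j => g.[j%:R / (N + s)%:R]) k))^`(2).[x]| <= 2 * A.
Proof.
move=> n0 x01 gA; set n := (N + s)%N in n0 *.
have A0 : 0 <= A by apply: le_trans (gA 0 _) => //; lra.
have nR : 0 < n%:R :> R by rewrite ltr0n.
have nR0 : n%:R != 0 :> R by rewrite gt_eqF.
set c0 := (fun k => _).
have small M : (M <= 1)%N -> (bform M c0)^`(2) = 0.
  case: M => [|[|//]] _; rewrite derivnS derivn1.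
    by rewrite deriv_bform0 deriv0.
  by rewrite deriv_bform derivZ deriv_bform0 scaler0.
have [N1|] := leqP N 1; first by rewrite small// horner0 mulr0 normr0 mulr_ge0.
case: N => [|[|N]]// in n n0 nR nR0 c0 small * => _.
have -> : x * (1 - x) * (bform N.+2 c0)^`(2).[x] = ('X * (1 - 'X) * (bform N.+2 c0)^`(2)).[x].
  by rewrite !hornerM hornerD hornerN hornerX hornerC.
rewrite phi2_deriv2_bform horner_sum.
have H k : (k <= N)%N -> `|(k.+1 * (N.+1 - k))%:R * fdiff (fdiff c0) k| <= 2 * A.
  move=> kN; pose h : R := n%:R^-1.
  have h0 : 0 < h by rewrite invr_gt0.
  (* The forward second difference of g. Its s-th derivative at c is the symmetric second difference
     of g^(s) about c + h. *)
  pose q := g \Po ('X + (2 * h)%:P) - 2 *: (g \Po ('X + h%:P)) + g.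
  have qE (y : R) : (q^`(s)).[y] =
      (g^`(s)).[y + h + h] - 2 * (g^`(s)).[y + h] + (g^`(s)).[y + h - h].
    rewrite /q derivnD derivnB derivnZ !derivn_compXD !hornerE !horner_comp !hornerE.
    by rewrite addrK mulrDl mul1r addrA.
  have e : fdiff (fdiff c0) k =
      (n ^_ s)%:R * iter s fdiff (fun j => (horner q^`(0)) (j%:R / n%:R)) k.
    rewrite /c0; set c1 := fun j => g.[_].
    have -> : fdiff (fdiff (fun k => (n ^_ s)%:R * iter s fdiff c1 k)) k =
       (n ^_ s)%:R * iter 2 fdiff (iter s fdiff c1) k by rewrite /= /fdiff; ring.
    rewrite -iterD addnC iterD; congr (_ * _); apply: eq_iter_fdiff => j.
    rewrite derivn0 /q !hornerD hornerN hornerZ !horner_comp !hornerD !hornerX !hornerC.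
    have e1 i : i.+1%:R / n%:R = i%:R / n%:R + h :> R by rewrite -natr1 mulrDl mul1r.
    rewrite (_ : 2 * h = h + h); last by rewrite mulrDl mul1r.
    by rewrite /= /fdiff /c1 !e1 addrA; ring.
  have [|i _|c /andP[c1 c2]] := iter_fdiff_node s (fun i => horner (q^`(i))) n k n0.
  - by rewrite /n; lia.
  - by rewrite derivnS; exact: difI_horner.
  rewrite e => ->; rewrite qE -/h.
  have k1 : (k + s)%:R * h + h + h <= 1.
    have : (k + s + 2)%:R <= n%:R :> R by rewrite ler_nat /n; lia.
    rewrite natrD => H; have : h * ((k + s)%:R + 2) <= h * n%:R by rewrite ler_pM2l.
    by rewrite /h mulVf// -/h; lra.
  have k2 : 0 <= k%:R * h by rewrite mulr_ge0// ltW.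
  have gA' z : 0 <= z <= 1 -> `|z * (1 - z) * ((g^`(s))^`(2)).[z]| <= A.
    by move=> z01; rewrite derivnS derivn1 -!derivnS; exact: gA.
  have := symdiff2_poly (g^`(s)) A (c + h) h gA' (ltW h0).
  rewrite -/h in c1 c2.
  set D := _ - _ + _ => /(_ ltac:(lra) ltac:(lra)) HD.
  rewrite !normrM !normr_nat normrX (gtr0_norm h0).
  (* As kh <= c <= (k+s)h and the degree n is N+2+s, c+h >= (k+1)h and 1-(c+h) >= (N+1-k)h: the
     discrete weight is dominated by the continuous one. *)
  have key : (k.+1 * (N.+1 - k))%:R * h ^+ 2 <= (c + h) * (1 - (c + h)).
    have -> : (k.+1 * (N.+1 - k))%:R * h ^+ 2 = (k%:R * h + h) * ((N.+1 - k)%:R * h).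
      by rewrite natrM -natr1; ring.
    apply: ler_pM; [lra|by rewrite mulr_ge0// ltW|lra|].
    have e2 : (N.+1 - k + (k + s) + 1)%:R = n%:R :> R by congr (_%:R); rewrite /n; clear -kN; lia.
    rewrite [LHS]natrD [X in X + _]natrD in e2.
    have : ((N.+1 - k)%:R + (k + s)%:R + 1) * h = 1 by rewrite e2 /h mulfV.
    lra.
  have key2 : (k.+1 * (N.+1 - k))%:R * h ^+ 2 * `|D| <= 2 * A * h ^+ 2.
    by apply: le_trans HD; apply: ler_wpM2r.
  have h20 : 0 < h ^+ 2 by rewrite exprn_gt0.
  rewrite -(ler_pM2r h20); apply: le_trans key2.
  set K := (_ * _)%:R.
  have -> : K * ((n ^_ s)%:R * (h ^+ s * `|D|)) * h ^+ 2 = ((n ^_ s)%:R * h ^+ s) * (K * h ^+ 2 * `|D|).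
    by ring.
  rewrite ler_piMl ?mulr_ge0// ?exprn_ge0 ?(ltW h0)//.
  rewrite /h exprVn ler_pdivrMr ?exprn_gt0// mul1r -natrX ler_nat; exact: ffact_ub.
apply: le_trans (ler_norm_sum _ _ _) _.
apply: (le_trans (_ : _ <= \sum_(k < N.+1) 2 * A * (bern N.+2 k.+1).[x])).
  apply: ler_sum => k _; rewrite hornerZ normrM (ger0_norm (bern_ge0 _ _ _ x01)).
  by apply: ler_wpM2r; [exact: bern_ge0|apply: H; rewrite -ltnS].
rewrite -mulr_sumr ler_piMr ?mulr_ge0//.
rewrite -(sum_bern1 N.+2 x) [X in _ <= X]big_ord_recl [X in _ <= _ + X]big_ord_recr /=.
rewrite addrCA lerDl addr_ge0// bern_ge0//.
Qed.

End FiniteDifferences.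

(** * Integer coefficients *)

Section IntegerCoefficients.
Context {R : realType}.
Implicit Types (f F : R -> R) (x y W e : R) (s n k : nat).

Lemma within01_continuousP F : {within `[0, 1], continuous F} ->
  forall x, 0 <= x <= 1 -> forall e, 0 < e -> exists2 d, 0 < d &
    forall y, 0 <= y <= 1 -> `|y - x| < d -> `|F y - F x| <= e.
Proof.
move=> /subspace_continuousP cF x x01 e e0.
have /cvgrPdist_le/(_ e e0) := cF x ltac:(by rewrite /= in_itv).
rewrite near_withinE => /nbhs_normP[d /= d0 dP]; exists d => // y y01 yx.
have := dP y; rewrite /= distrC in_itv /= => /(_ yx y01).
by rewrite distrC.
Qed.

(** Since the derivatives of order 2 to s vanish at x0, the tangent line is the Taylor polynomial of
    order s. Its s-th derivative is the constant F(x0), also when s = 1. *)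
Lemma taylor_end s f x0 y W : (0 < s)%N -> C01 s f -> 0 <= x0 <= 1 -> 0 <= y <= 1 ->
  (forall i : nat, (2 <= i <= s)%N -> derive01n i f x0 = 0) ->
  (forall z, 0 <= z <= 1 -> `|z - x0| <= `|y - x0| ->
     `|derive01n s f z - derive01n s f x0| <= W) ->
  `|f y - (f x0 + derive01n 1 f x0 * (y - x0))| <= W * `|y - x0| ^+ s.
Proof.
move=> s0 fC x01 y01 d0 FW.
pose p : {poly R} := (f x0)%:P + derive01n 1 f x0 *: ('X - x0%:P).
have pE z : p.[z] = f x0 + derive01n 1 f x0 * (z - x0) by rewrite /p !hornerE.
have dp : p^`() = (derive01n 1 f x0)%:P.
  by rewrite /p derivD derivZ derivB !derivC derivX subr0 add0r alg_polyC.
have dpE i z : (0 < i <= s)%N -> (p^`(i)).[z] = derive01n i f x0.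
  case: i => [|[|i]]// h; first by rewrite derivn1 dp hornerC.
  by rewrite d0// derivSn dp derivSn derivC derivn_poly0 ?size_poly0// horner0.
pose u i (z : R) := derive01n i f z - (p^`(i)).[z].
have := taylor_bound s u x0 `|y - x0| W x01 _ _ _ y y01 (lexx _).
have -> : f y - (f x0 + derive01n 1 f x0 * (y - x0)) = u 0%N y by rewrite /u derivn0 pE.
apply.
- move=> i si; apply: difIB; first exact: (C01_difI s).
  by rewrite derivnS; exact: difI_horner.
- move=> [|i] si; rewrite /u; first by rewrite derivn0 pE subrr mulr0 addr0 /= subrr.
  by rewrite dpE ?subrr//= ltnW.
- by move=> z z01 zx; rewrite /u dpE ?s0 ?leqnn//; exact: FW.
Qed.

Definition floor_coef n f k : R :=
  (Num.floor (f (k%:R / n%:R) * 'C(n, k)%:R))%:~R / 'C(n, k)%:R.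

Lemma intBernstein_bform n f x :
  intBernstein n f x = (bform n (floor_coef n f)).[x].
Proof.
rewrite /intBernstein bformE; apply: eq_bigr => k _.
have C0 : 'C(n, k)%:R != 0 :> R by rewrite pnatr_eq0 -lt0n bin_gt0 -ltnS.
by rewrite bernE /floor_coef mulrA divfK// mulrA.
Qed.

Lemma floor_coef_mid n f k : (k <= n)%N ->
  `|f (k%:R / n%:R) - floor_coef n f k| <= 'C(n, k)%:R^-1.
Proof.
move=> kn; have C0 : 0 < 'C(n, k)%:R :> R by rewrite ltr0n bin_gt0.
rewrite /floor_coef -(ler_pM2r C0) mulVf ?gt_eqF//.
rewrite -[X in _ * X](gtr0_norm C0) -normrM mulrBl divfK ?gt_eqF//.
set z := _ * _; have := Num.Theory.floor_itv z; rewrite intrD => /andP[z1 z2].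
by rewrite ger0_norm; lra.
Qed.

Lemma floor_coef_eq n f k L : (k <= n)%N -> L * 'C(n, k)%:R \is a Num.int ->
  L <= f (k%:R / n%:R) -> (f (k%:R / n%:R) - L) * 'C(n, k)%:R < 1 ->
  floor_coef n f k = L.
Proof.
move=> kn /Num.Theory.intrP[m Lm] Lf fL; have C0 : 0 < 'C(n, k)%:R :> R by rewrite ltr0n bin_gt0.
rewrite /floor_coef (Num.Theory.floor_def (m := m)).
  by rewrite -Lm mulfK// gt_eqF.
by rewrite intrD -Lm ler_pM2r// Lf; move: fL; rewrite mulrBl; lra.
Qed.

(** Integrality rests on k C(n,k) = n C(n-1,k-1). *)
Lemma bin_int0 n k (a b : R) : (k <= n)%N -> (0 < n)%N ->
  a \is a Num.int -> b \is a Num.int ->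
  (a + b * (k%:R / n%:R)) * 'C(n, k)%:R \is a Num.int.
Proof.
move=> kn n0 ai bi; have nR : n%:R != 0 :> R by rewrite pnatr_eq0 -lt0n.
have [m hm] : exists m : nat, (k * 'C(n, k) = n * m)%N.
  case: k kn => [|k] kn; first by exists 0%N; rewrite muln0.
  by exists 'C(n.-1, k); rewrite mul_bin_diag.
have -> : (a + b * (k%:R / n%:R)) * 'C(n, k)%:R = a * 'C(n, k)%:R + b * m%:R.
  have : k%:R * 'C(n, k)%:R = n%:R * m%:R :> R by rewrite -!natrM hm.
  move=> h; rewrite mulrDl -!mulrA; congr (_ + _ * _).
  by rewrite mulrCA h mulKf.
by rewrite rpredD ?rpredM ?natr_int.
Qed.

Lemma bin_int1 n k (a b : R) : (k <= n)%N -> (0 < n)%N ->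
  a \is a Num.int -> b \is a Num.int ->
  (a + b * (k%:R / n%:R - 1)) * 'C(n, k)%:R \is a Num.int.
Proof.
move=> kn n0 ai bi.
rewrite (_ : a + b * (k%:R / n%:R - 1) = a - b + b * (k%:R / n%:R)); last by ring.
by rewrite bin_int0// rpredB.
Qed.

(* Near an end point x0 the coefficient is exactly that of the tangent line. *)
Lemma floor_coef_end s n f k x0 W w : (0 < s)%N -> (0 < n)%N -> C01 s f ->
  0 <= x0 <= 1 -> (k <= n)%N -> `|k%:R / n%:R - x0| <= s%:R / n%:R ->
  ('C(n, k) <= n ^ s)%N -> s%:R ^+ s * w < 1 ->
  (forall i : nat, (2 <= i <= s)%N -> derive01n i f x0 = 0) ->
  (f x0 + derive01n 1 f x0 * (k%:R / n%:R - x0)) * 'C(n, k)%:R \is a Num.int ->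
  f x0 + derive01n 1 f x0 * (k%:R / n%:R - x0) <= f (k%:R / n%:R) ->
  (forall z, 0 <= z <= 1 -> `|z - x0| <= s%:R / n%:R ->
     `|derive01n s f z - derive01n s f x0| <= w) ->
  (forall z, 0 <= z <= 1 -> `|z - x0| <= s%:R / n%:R ->
     `|derive01n s f z - derive01n s f x0| <= W) ->
  `|f (k%:R / n%:R) - floor_coef n f k| <= W * (s%:R / n%:R) ^+ s.
Proof.
move=> s0 n0 fC x01 kn kx Cn w1 df0 Li Lf Fw FW.
have nR : 0 < n%:R :> R by rewrite ltr0n.
have k01 : 0 <= (k%:R / n%:R : R) <= 1.
  by rewrite divr_ge0//= ler_pdivrMr// mul1r ler_nat.
(* Used twice: with W for the stated error, and with the fixed small w to keep the excess of f over
   the tangent line, times C(n,k) <= n^s, below s^s w < 1. *)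
have T V : (forall z, 0 <= z <= 1 -> `|z - x0| <= s%:R / n%:R ->
     `|derive01n s f z - derive01n s f x0| <= V) ->
    `|f (k%:R / n%:R) - (f x0 + derive01n 1 f x0 * (k%:R / n%:R - x0))|
      <= V * (s%:R / n%:R) ^+ s.
  move=> FV; have V0 : 0 <= V.
    by apply: le_trans (FV x0 x01 _) => //; rewrite subrr normr0 divr_ge0.
  apply: le_trans (taylor_end s f x0 _ V s0 fC x01 k01 df0 _) _.
    by move=> z z01 zx; apply: FV => //; exact: le_trans kx.
  by rewrite ler_wpM2l// lerXn2r ?nnegrE ?normr_ge0 ?divr_ge0.
rewrite (floor_coef_eq n f k _ kn Li Lf); first exact: T.
have w0 : 0 <= w by apply: le_trans (Fw x0 x01 _) => //; rewrite subrr normr0 divr_ge0.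
have h1 := T w Fw; rewrite ger0_norm ?subr_ge0// in h1.
apply: le_lt_trans w1.
apply: le_trans (ler_pM _ _ h1 (_ : _ <= (n ^ s)%:R)) _; rewrite ?subr_ge0 ?ler_nat//.
by rewrite natrX exprMn exprVn -mulrA divfK ?expf_neq0 ?gt_eqF// mulrC.
Qed.

Lemma floor_coef_dist s f : (0 < s)%N -> C01 s f ->
  f 0 \is a Num.int -> f 1 \is a Num.int ->
  derive01n 1 f 0 \is a Num.int -> derive01n 1 f 1 \is a Num.int ->
  (forall i : nat, (2 <= i <= s)%N -> derive01n i f 0 = 0 /\ derive01n i f 1 = 0) ->
  (exists n0 : nat, [/\ (0 < n0)%N, (s <= n0)%N,
     forall n k : nat, (n0 <= n)%N -> (1 <= k <= s)%N ->
       f (k%:R / n%:R) >= f 0 + k%:R / n%:R * derive01n 1 f 0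
   & forall n k : nat, (n0 <= n)%N -> (n - s <= k <= n - 1)%N ->
       f (k%:R / n%:R) >= f 1 - (1 - k%:R / n%:R) * derive01n 1 f 1]) ->
  exists K n1, [/\ 0 <= K, (s.+1 < n1)%N & forall n W, (n1 <= n)%N ->
    (forall x y, 0 <= x <= 1 -> 0 <= y <= 1 -> `|x - y| <= s%:R / n%:R ->
       `|derive01n s f x - derive01n s f y| <= W) ->
    forall k, (k <= n)%N ->
      `|f (k%:R / n%:R) - floor_coef n f k| <= K * (n%:R^-1 ^+ s * (n%:R^-1 + W))].
Proof.
move=> s0 fC f0i f1i df0i df1i df0 [n0 [n00 sn0 fge0 fge1]].
pose w : R := (s%:R ^+ s + 1)^-1.
have ss : 0 <= s%:R ^+ s :> R by rewrite exprn_ge0.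
have w0 : 0 < w by rewrite invr_gt0; lra.
have w1 : s%:R ^+ s * w < 1 by rewrite ltr_pdivrMr; lra.
have [d0 d00 Fd0] := within01_continuousP _ fC.2 0 ltac:(lra) w w0.
have [d1 d10 Fd1] := within01_continuousP _ fC.2 1 ltac:(lra) w w0.
pose d := Num.min d0 d1; have dgt0 : 0 < d by rewrite lt_min d00.
have [m sm] : exists m : nat, s%:R / d < m%:R.
  by exists (Num.truncn (s%:R / d)).+1; exact: truncnS_gt.
(* The two terms of the constant serve the middle and the end coefficients. In the threshold, [n0]
   is for the inequalities on f, [m] for s/n < d, and 2(s+1) leaves room for the middle range. *)
exists ((2 ^ s.+1 * s.+1`!)%:R + s%:R ^+ s), (n0 + m + 2 * s.+1)%N; split.
- by rewrite addr_ge0.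
- by clear; lia.
move=> n W nn1 FW k kn.
have [nn0 nm ns n0'] : [/\ n0 <= n, m <= n, 2 * s.+1 <= n & 0 < n]%N.
  by clear -nn1; split; lia.
have nR : 0 < n%:R :> R by rewrite ltr0n.
have W0 : 0 <= W.
  by apply: le_trans (FW 0 0 _ _ _); rewrite ?normr_ge0 ?lexx ?ler01// subrr normr0 divr_ge0.
have snd : s%:R / n%:R < d.
  rewrite ltr_pdivrMr// mulrC -ltr_pdivrMr//.
  by apply: lt_le_trans sm _; rewrite ler_nat.
have ni : 0 <= n%:R^-1 :> R by rewrite invr_ge0.
have E : W * (s%:R / n%:R) ^+ s <=
    ((2 ^ s.+1 * s.+1`!)%:R + s%:R ^+ s) * (n%:R^-1 ^+ s * (n%:R^-1 + W)).
  rewrite exprMn mulrCA ler_pM ?mulr_ge0 ?exprn_ge0 ?lerDr//.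
  by rewrite mulrC ler_wpM2l ?exprn_ge0// lerDr.
have [ks|sk] := leqP k s.
  apply: le_trans E; apply: (floor_coef_end s n f k 0 W w) => //.
  - by rewrite lexx ler01.
  - by rewrite subr0 ger0_norm ?divr_ge0// ler_wpM2r// ler_nat.
  - by apply: leq_trans (bin_ub n k) _; rewrite leq_pexp2l.
  - by move=> i /df0[].
  - by rewrite subr0; exact: bin_int0.
  (* The hypothesis starts at k = 1; at k = 0 the tangent line meets f. The index k = n is treated
     alike below. *)
  - case: k kn ks => [|k] kn ks; first by rewrite mul0r subrr mulr0 addr0.
    by rewrite subr0 mulrC; exact: fge0.
  - move=> z z01 zx; apply: Fd0 => //; apply: le_lt_trans zx _.
    by apply: lt_le_trans snd _; rewrite ge_min lexx.
  - by move=> z z01 zx; apply: FW => //; rewrite lexx ler01.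
have [nsk|kns] := leqP (n - s) k.
  have nk : n%:R - k%:R = (n - k)%:R :> R by rewrite natrB.
  apply: le_trans E; apply: (floor_coef_end s n f k 1 W w) => //.
  - by rewrite lexx ler01.
  - rewrite distrC -{1}(divff (lt0r_neq0 nR)) -mulrBl nk ger0_norm ?divr_ge0//.
    by rewrite ler_wpM2r// ler_nat leq_subCl.
  - rewrite -bin_sub//; apply: leq_trans (bin_ub n _) _.
    by rewrite leq_pexp2l// leq_subCl.
  - by move=> i /df0[].
  - exact: bin_int1.
  - have [->|kn'] := eqVneq k n; first by rewrite divff ?gt_eqF// subrr mulr0 addr0.
    rewrite (_ : _ + _ = f 1 - (1 - k%:R / n%:R) * derive01n 1 f 1); last by ring.
    by apply: fge1 => //; clear -kn kn' nsk; lia.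
  - move=> z z01 zx; apply: Fd1 => //; apply: le_lt_trans zx _.
    by apply: lt_le_trans snd _; rewrite ge_min lexx orbT.
  - by move=> z z01 zx; apply: FW => //; rewrite lexx ler01.
(* Here s < k < n-s, that is s+1 <= k and k+s+1 <= n, so [bin_lb_mid] applies with exponent s+1. *)
apply: le_trans (floor_coef_mid n f k kn) _.
have C0 : 0 < 'C(n, k)%:R :> R by rewrite ltr0n bin_gt0.
set c := _%:R + _.
have c0 : 0 < c by rewrite ltr_pwDl// ltr0n muln_gt0 expn_gt0 fact_gt0.
have nW : 0 < n%:R^-1 + W by rewrite ltr_pwDl// invr_gt0.
rewrite invf_ple ?posrE//; last by rewrite !mulr_gt0 ?exprn_gt0 ?invr_gt0.
apply: (le_trans (_ : _ <= (c * n%:R^-1 ^+ s.+1)^-1)).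
  rewrite lef_pV2 ?posrE ?mulr_gt0 ?exprn_gt0 ?invr_gt0//.
  by rewrite ler_wpM2l ?(ltW c0)// exprSr ler_wpM2l ?exprn_ge0// lerDl.
rewrite invfM exprVn invrK mulrC ler_pdivrMr//.
apply: (le_trans (_ : _ <= (2 ^ s.+1 * s.+1`! * 'C(n, k))%:R)).
  by rewrite -natrX ler_nat bin_lb_mid//; clear -sk kns; lia.
by rewrite natrM mulrC ler_wpM2l// lerDl.
Qed.

End IntegerCoefficients.

(** * Direct and inverse rates *)

(** The estimate n^s - n(n-1)...(n-s+1) <= s^2 n^(s-1), arranged to avoid subtraction in [nat]. *)
Lemma ffact_exp_close n s : (s <= n)%N -> (n ^ s * n <= n ^_ s * n + s ^ 2 * n ^ s)%N.
Proof.
elim: s => [|s ih] sn; first by rewrite !ffactn0 expn0; lia.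
have := ih (ltnW sn); have := ffact_ub n s; rewrite ffactnSr [(n ^ s.+1)%N]expnSr.
move: (n ^_ s)%N (n ^ s)%N => a b ab h.
have [m nE] : exists m, n = (m + s)%N by exists (n - s)%N; rewrite subnK// ltnW.
have -> : (n - s)%N = m by rewrite nE addnK.
have h4 : (a * n * n = a * m * n + a * (s * n))%N.
  by rewrite -!mulnA -mulnDr -mulnDl -nE.
have h2 : (b * n * n <= (a * n + s ^ 2 * b) * n)%N by rewrite leq_mul.
have h3 : (a * (s * n) <= b * (s * n))%N by rewrite leq_mul.
have e : (s.+1 ^ 2 * (b * n) = s ^ 2 * b * n + b * (s * n) + b * (s * n) + b * n)%N.
  by rewrite -addn1 sqrnD; ring.
apply: leq_trans h2 _; rewrite mulnDl h4 e; clear - h3.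
move: h3; move: (a * (s * n))%N (b * (s * n))%N (a * m * n)%N (s ^ 2 * b * n)%N; lia.
Qed.

Section Rates.
Context {R : realType}.
Implicit Types (f F : R -> R) (x y t al C D K M W A : R) (s n k N : nat) (g p : {poly R}).

(** Expresses omega_1(F, s/n) <= W without a supremum. *)
Definition oscillation_bound s F n W := forall x y, 0 <= x <= 1 -> 0 <= y <= 1 ->
  `|x - y| <= s%:R / n%:R -> `|F x - F y| <= W.

Definition coef_error_bound s f K n1 := forall n W, (n1 <= n)%N ->
  oscillation_bound s (derive01n s f) n W -> forall k, (k <= n)%N ->
  `|f (k%:R / n%:R) - floor_coef n f k| <= K * (n%:R^-1 ^+ s * (n%:R^-1 + W)).

Definition floor_deriv s f n : {poly R} := (bform n (floor_coef n f))^`(s).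

Lemma ffact_scale n s : (0 < n)%N ->
  0 <= ((n ^_ s)%:R * n%:R^-1 ^+ s : R) <= 1.
Proof.
move=> n0; have nR : 0 < n%:R :> R by rewrite ltr0n.
rewrite mulr_ge0 ?exprn_ge0 ?invr_ge0//= exprVn ler_pdivrMr ?exprn_gt0// mul1r.
by rewrite -natrX ler_nat ffact_ub.
Qed.

Lemma ffact_scale_close n s : (0 < n)%N -> (s <= n)%N ->
  1 - (n ^_ s)%:R * n%:R^-1 ^+ s <= (s ^ 2)%:R * n%:R^-1 :> R.
Proof.
move=> n0 sn; have nR : 0 < n%:R :> R by rewrite ltr0n.
have ns : 0 < n%:R ^+ s :> R by rewrite exprn_gt0.
rewrite lerBlDr -(ler_pM2r (mulr_gt0 ns nR)) mul1r.
rewrite [X in _ <= X](_ : _ = (n ^_ s * n + s ^ 2 * n ^ s)%:R).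
  by rewrite -natrX -natrM ler_nat ffact_exp_close.
rewrite exprVn; move: (s ^ 2)%N => s2; rewrite natrD !natrM natrX; field.
by rewrite expf_neq0 ?gt_eqF.
Qed.

Lemma floor_derivE s f N : floor_deriv s f (N + s) =
  bform N (fun k => ((N + s) ^_ s)%:R * iter s fdiff (floor_coef (N + s) f) k).
Proof. by rewrite /floor_deriv derivn_bform bformZ. Qed.

(** Taking s differences costs 2^s, and the falling factorial is at most n^s, which cancels the n^-s
    in the coefficient error. *)
Lemma floor_coef_fdiff_err s f K n1 N W : (0 < N + s)%N -> (n1 <= N + s)%N ->
  coef_error_bound s f K n1 -> oscillation_bound s (derive01n s f) (N + s) W ->
  forall k, (k <= N)%N ->
  `|((N + s) ^_ s)%:R * iter s fdiff
     (fun j => f (j%:R / (N + s)%:R) - floor_coef (N + s) f j) k|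
   <= 2 ^+ s * K * ((N + s)%:R^-1 + W).
Proof.
move=> n0 n1n HK oW k kN; set n := (N + s)%N in n0 n1n oW *.
have nR : 0 < n%:R :> R by rewrite ltr0n.
have H : `|iter s fdiff (fun j => f (j%:R / n%:R) - floor_coef n f j) k| <=
    2 ^+ s * (K * (n%:R^-1 ^+ s * (n%:R^-1 + W))).
  by apply: (iter_fdiff_bound _ _ _ N) => // j jn; exact: HK.
rewrite normrM normr_nat.
apply: le_trans (ler_wpM2l (ler0n _ _) H) _.
have -> : (n ^_ s)%:R * (2 ^+ s * (K * (n%:R^-1 ^+ s * (n%:R^-1 + W)))) =
  ((n ^_ s)%:R * n%:R^-1 ^+ s) * (2 ^+ s * K * (n%:R^-1 + W)) by ring.
have /andP[g0 g1] := ffact_scale n s n0.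
rewrite ler_piMl//.
have Q0 : 0 <= 2 ^+ s * (K * (n%:R^-1 ^+ s * (n%:R^-1 + W))) by exact: le_trans H.
have ns : 0 < n%:R^-1 ^+ s :> R by rewrite exprn_gt0// invr_gt0.
rewrite -(pmulr_rge0 _ ns); apply: le_trans Q0 _.
by rewrite le_eqVlt; apply/orP; left; apply/eqP; ring.
Qed.

Lemma powR_le1 al x : 0 <= al -> 0 <= x <= 1 -> x `^ al <= 1.
Proof.
move=> al0 /andP[x0 x1].
apply: (le_trans (_ : _ <= 1 `^ al)); last by rewrite powR1.
by apply: ge0_ler_powR; rewrite ?nnegrE.
Qed.

Lemma powR_ge1 al x : 0 <= al -> 1 <= x -> 1 <= x `^ al.
Proof.
move=> al0 x1; apply: (le_trans (_ : _ <= 1 `^ al)); first by rewrite powR1.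
by apply: ge0_ler_powR => //; rewrite nnegrE (le_trans ler01).
Qed.

Lemma powR_scale al (m : nat) x : 0 <= al <= 1 -> (0 < m)%N -> 0 <= x ->
  (m%:R * x) `^ al <= m%:R * x `^ al.
Proof.
move=> /andP[al0 al1] m0 x0; rewrite powRM// ler_wpM2r ?powR_ge0//.
by apply: ler1_powR => //; rewrite ler1n.
Qed.

Lemma inv_le_powRN al n : al <= 1 -> (0 < n)%N -> n%:R^-1 <= n%:R `^ (- al) :> R.
Proof.
move=> al1 n0; rewrite -powR_inv1 ?ler0n// ler_powR ?ler1n//; lra.
Qed.

Lemma holder_oscillation s F al C n : 0 <= al <= 1 -> 0 <= C -> (0 < n)%N -> (0 < s)%N ->
  (forall x y, 0 <= x <= 1 -> 0 <= y <= 1 -> `|F x - F y| <= C * `|x - y| `^ al) ->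
  oscillation_bound s F n (C * (s%:R * n%:R `^ (- al))).
Proof.
move=> al01 C0 n0 s0 hF x y x01 y01 xy; apply: le_trans (hF x y x01 y01) _.
rewrite ler_wpM2l// (powRNV _ _ (ler0n _ _)).
apply: le_trans (powR_scale al s n%:R^-1 al01 s0 _); last by rewrite invr_ge0.
by apply: ge0_ler_powR; rewrite ?nnegrE ?divr_ge0//; lra.
Qed.

Lemma direct_rate s f al C K n1 : (0 < s)%N -> C01 s f -> 0 <= al <= 1 -> 0 <= C ->
  0 <= K -> coef_error_bound s f K n1 ->
  (forall x y, 0 <= x <= 1 -> 0 <= y <= 1 ->
     `|derive01n s f x - derive01n s f y| <= C * `|x - y| `^ al) ->
  (forall y u v : R, 0 <= v -> 0 <= u -> 0 <= y - u -> y + u <= 1 ->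
     u ^+ 2 <= v * (y * (1 - y)) ->
     `|derive01n s f (y + u) - 2 * derive01n s f y + derive01n s f (y - u)| <= C * v `^ al) ->
  exists K', forall n, (n1 + 2 * s <= n)%N -> forall x, 0 <= x <= 1 ->
     `|(floor_deriv s f n).[x] - derive01n s f x| <= K' * n%:R `^ (- al).
Proof.
move=> s0 fC al01 C0 K0 HK hF zF; set F := derive01n s f in hF zF *.
pose B := `|F 0| + C.
have FB y : 0 <= y <= 1 -> `|F y| <= B.
  move=> y01; have := hF y 0 y01 ltac:(lra).
  rewrite subr0 (ger0_norm (_ : 0 <= y)); last by lra.
  have : y `^ al <= 1 by apply: powR_le1 => //; lra.
  move=> /(ler_wpM2l C0); rewrite mulr1 => h1 h2.
  have := ler_normD (F y - F 0) (F 0); rewrite subrK /B; lra.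
have B0 : 0 <= B by rewrite addr_ge0.
(* The terms account for n(n-1)...(n-s+1) n^-s differing from 1, for moving the mean value point to
   k/N, and for the rounding. *)
pose K1 := (s ^ 2)%:R * B + C * s%:R + 2 ^+ s * K * (1 + C * s%:R).
exists (K1 + 2 * (50 * C)) => n nn x x01.
have {nn} [N n_eq [N0 sN n1N]] : exists2 N, n = (N + s)%N &
    [/\ (0 < N)%N, (s <= N)%N & (n1 <= N + s)%N].
  by exists (n - s)%N; [clear -nn|clear -nn s0; split]; lia.
rewrite {}n_eq; clear n; have n0 : (0 < N + s)%N by rewrite addn_gt0 N0.
have nR : 0 < (N + s)%:R :> R by rewrite ltr0n.
have NR : 0 < N%:R :> R by rewrite ltr0n.
set q : R := (N + s)%:R `^ (- al).
have q0 : 0 <= q by exact: powR_ge0.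
have oW := holder_oscillation s F al C _ al01 C0 n0 s0 hF.
have niq : (N + s)%:R^-1 <= q by apply: inv_le_powRN => //; lra.
have c_err k : (k <= N)%N -> `|((N + s) ^_ s)%:R * iter s fdiff (floor_coef (N + s) f) k
   - F (k%:R / N%:R)| <= K1 * q.
  move=> kN.
  have err := floor_coef_fdiff_err s f K n1 N _ n0 n1N HK oW k kN.
  have [|xi /andP[xi1 xi2] fxi] := iter_fdiff_node s (fun i => derive01n i f) (N + s) k n0 _
      (fun i si => C01_difI s f i fC si).
    by rewrite leq_add2r.
  rewrite iter_fdiffB {}fxi -/F in err.
  set n := (N + s)%N in err *.
  set a := (n ^_ s)%:R in err *; set b := iter s fdiff _ k in err *.
  have gm := ffact_scale_close n s n0 (leq_addl _ _).
  have /andP[gm0 gm1] := ffact_scale n s n0.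
  rewrite -/a in gm gm0 gm1; set ga := a * _ in gm gm0 gm1.
  have xi01 : 0 <= xi <= 1.
    apply/andP; split; first by apply: le_trans xi1; rewrite divr_ge0.
    by apply: le_trans xi2 _; rewrite ler_pdivrMr// mul1r ler_nat leq_add2r.
  have kN01 : 0 <= (k%:R / N%:R : R) <= 1.
    by rewrite divr_ge0//= ler_pdivrMr// mul1r ler_nat.
  (* Both k/N and the mean value point lie in [k/n, (k+s)/n], so they are at most s/n apart. *)
  have kk1 : k%:R / n%:R <= k%:R / N%:R :> R.
    by rewrite ler_wpM2l// lef_pV2 ?posrE// ler_nat leq_addr.
  have kk2 : k%:R / N%:R <= (k + s)%:R / n%:R :> R.
    rewrite ler_pdivrMr// mulrAC ler_pdivlMr// -!natrM ler_nat /n.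
    by clear -kN; nia.
  have dxi : `|F xi - F (k%:R / N%:R)| <= C * (s%:R * q).
    apply: oW => //; rewrite -/n.
    have : (k + s)%:R / n%:R = k%:R / n%:R + s%:R / n%:R :> R by rewrite natrD mulrDl.
    by move=> h; rewrite ler_norml; lra.
  have e : a * b - F (k%:R / N%:R) = - (a * (n%:R^-1 ^+ s * F xi - b)) -
      (1 - ga) * F xi + (F xi - F (k%:R / N%:R)).
    by rewrite /ga; ring.
  rewrite e; apply: le_trans (ler_normD _ _) _.
  have h1 : `|(1 - ga) * F xi| <= (s ^ 2)%:R * q * B.
    rewrite normrM ger0_norm ?subr_ge0//; apply: ler_pM => //.
    - by rewrite subr_ge0.
    - by apply: le_trans gm _; rewrite ler_wpM2l.
    - exact: FB.
  have h2 := ler_normB (- (a * (n%:R^-1 ^+ s * F xi - b))) ((1 - ga) * F xi).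
  rewrite normrN in h2.
  have h3 : 2 ^+ s * K * (n%:R^-1 + C * (s%:R * q)) <= 2 ^+ s * K * (q + C * (s%:R * q)).
    by rewrite ler_wpM2l ?mulr_ge0 ?exprn_ge0// lerD2r.
  rewrite -/q in err; rewrite /K1; lra.
rewrite floor_derivE -[in X in `|X|](subrK (bform N (fun k => F (k%:R / N%:R))).[x] (bform N _).[x]).
rewrite -addrA (le_trans (ler_normD _ _))// mulrDl lerD//.
  by rewrite -hornerN -hornerD bformB; apply: bform_bound.
have Nq : N%:R `^ (- al) <= 2 * q.
  rewrite (powRNV _ _ (ltW NR)) /q (powRNV _ _ (ltW nR)).
  apply: (le_trans (_ : _ <= (2 * (N + s)%:R^-1) `^ al)).
    apply: ge0_ler_powR; rewrite ?nnegrE ?mulr_ge0 ?invr_ge0//; first by lra.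
    rewrite -[X in X <= _]mul1r ler_pdivrMr// mulrAC ler_pdivlMr// mul1r -natrM ler_nat.
    by clear -sN; lia.
  by apply: powR_scale => //; rewrite invr_ge0.
have CN : C * N%:R `^ (- al) <= 2 * C * q.
  by rewrite [2 * C]mulrC -mulrA ler_wpM2l.
have Cq : 0 <= C * q by rewrite mulr_ge0.
have [Np|Np] := leP (N%:R * (x * (1 - x))) 1.
  have := bern_approx_endpoints al C F N x al01 C0 N0 hF x01 Np; lra.
have := bern_approx_interior al C F N x al01 C0 N0 (ex_intro _ B FB) zF x01 Np; lra.
Qed.

(** The first derivative controls omega_1 and the weighted second one omega_phi^2. They share one
    bound because the iteration gives both the same growth. *)
Definition smooth_bound p A := forall z, 0 <= z <= 1 ->
  `|p^`().[z]| <= A /\ `|z * (1 - z) * (p^`(2)).[z]| <= A.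

Lemma smooth_bound_lipschitz p A x y : smooth_bound p A -> 0 <= x <= 1 -> 0 <= y <= 1 ->
  `|p.[x] - p.[y]| <= A * `|x - y|.
Proof.
wlog xy : x y / x <= y => [W pA x01 y01|pA x01 y01].
  have [xy|/ltW yx] := leP x y; first exact: W.
  by rewrite distrC [ `|x - y|]distrC; exact: W.
have [|||c cxy e] := difI_MVT x y _ _ x y (difI_horner x y p); rewrite ?lexx//.
rewrite distrC e normrM [ `|x - y|]distrC ler_wpM2r//.
by apply: (pA c _).1; lra.
Qed.

Lemma smooth_bound_exists N (c : nat -> R) : exists A, smooth_bound (bform N c) A.
Proof.
pose M := \sum_(k < N.+1) `|c k|.
have cM k : (k <= N)%N -> `|c k| <= M.
  rewrite -ltnS => kN; rewrite /M (bigD1 (Ordinal kN))//= lerDl sumr_ge0//.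
have M0 : 0 <= M by rewrite sumr_ge0.
exists (4 * N%:R * M) => z z01; split.
  apply: le_trans (deriv_bform_bound N c M z z01 cM) _.
  by rewrite !ler_wpM2r// ler_nat.
exact: phi2_deriv2_bform_bound.
Qed.

(** T_n^(s) is the s-th derivative of the Bernstein polynomial of g, which inherits the smoothness
    of g^(s), plus a form with small coefficients, on which differentiation costs a factor n. Later
    g is an earlier T_m. *)
Lemma converse_step s f K n1 : (0 < s)%N -> C01 s f -> 0 <= K -> coef_error_bound s f K n1 ->
  exists2 C, 1 <= C & forall n g D A, (n1 + s < n)%N -> 
   (forall z, 0 <= z <= 1 -> `|(g^`(s)).[z] - derive01n s f z| <= D) ->
   smooth_bound (g^`(s)) A ->
   smooth_bound (floor_deriv s f n) (C * (n%:R * D + A + 1)).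
Proof.
move=> s0 fC K0 HK; set F := derive01n s f.
exists (6 + 8 * (2 ^+ s * K) + 4 * (2 ^+ s * K) * s%:R).
  have := mulr_ge0 (exprn_ge0 s (ler0n R 2)) K0.
  by move=> h; have := mulr_ge0 h (ler0n R s); lra.
move=> n g D A nn gD gA.
have {nn} [N n_eq [N0 n1N]] : exists2 N, n = (N + s)%N & (0 < N)%N /\ (n1 <= N + s)%N.
  by exists (n - s)%N; [clear -nn|clear -nn s0; split]; lia.
rewrite {}n_eq; clear n; have n0 : (0 < N + s)%N by rewrite addn_gt0 N0.
have nR : 0 < (N + s)%:R :> R by rewrite ltr0n.
have z0 : 0 <= (0 : R) <= 1 by rewrite lexx ler01.
have D0 : 0 <= D by apply: le_trans (gD 0 z0).
have A0 : 0 <= A by apply: le_trans (gA 0 z0).1.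
pose W := 2 * D + A * (s%:R / (N + s)%:R).
have oW : oscillation_bound s F (N + s) W.
  move=> x y x01 y01 xy.
  have h1 := gD x x01; have h2 := gD y y01; rewrite distrC -/F in h1.
  have h3 := smooth_bound_lipschitz _ _ x y gA x01 y01.
  have h4 := ler_wpM2l A0 xy.
  have -> : F x - F y = (F x - (g^`(s)).[x]) + ((g^`(s)).[x] - (g^`(s)).[y]) + ((g^`(s)).[y] - F y).
    by ring.
  apply: le_trans (ler_normD _ _) _.
  apply: le_trans (lerD (ler_normD _ _) (lexx _)) _.
  by rewrite /W -/F in h2 *; lra.
have err := floor_coef_fdiff_err s f K n1 N _ n0 n1N HK oW.
set n := (N + s)%N in n0 n1N nR W oW err *.
set a := (n ^_ s)%:R in err *.
pose c2 k : R := a * iter s fdiff (fun j => g.[j%:R / n%:R]) k.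
pose c1 k : R := a * iter s fdiff (floor_coef n f) k - c2 k.
pose M := D + 2 ^+ s * K * (n%:R^-1 + W).
have c1M k : (k <= N)%N -> `|c1 k| <= M.
  move=> kN; have {err} := err k kN; rewrite iter_fdiffB mulrBr.
  have [||xi /andP[xi1 xi2]] := iter_fdiff_node s
     (fun i z => derive01n i f z - (g^`(i)).[z]) n k n0.
  - by rewrite leq_add2r.
  - move=> i si; apply: difIB; first exact: (C01_difI s).
    by rewrite derivnS; exact: difI_horner.
  rewrite derivn0 iter_fdiffB -/F => e err.
  have xi01 : 0 <= xi <= 1.
    apply/andP; split; first by apply: le_trans xi1; rewrite divr_ge0.
    by apply: le_trans xi2 _; rewrite ler_pdivrMr// mul1r ler_nat leq_add2r.
  have h : `|a * (n%:R^-1 ^+ s * (F xi - (g^`(s)).[xi]))| <= D.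
    have /andP[gm0 gm1] := ffact_scale n s n0.
    rewrite mulrA normrM ger0_norm// -[X in _ <= X]mul1r; apply: ler_pM => //.
    by rewrite distrC; exact: gD.
  rewrite -e mulrBr in h.
  rewrite /c1 /c2 /M.
  rewrite (_ : _ - _ = (a * iter s fdiff (fun j => f (j%:R / n%:R)) k -
      a * iter s fdiff (fun j => g.[j%:R / n%:R]) k) -
    (a * iter s fdiff (fun j => f (j%:R / n%:R)) k -
      a * iter s fdiff (floor_coef n f) k)); last by ring.
  by apply: le_trans (ler_normB _ _) _; apply: lerD.
have dE : floor_deriv s f n = bform N c1 + bform N c2.
  by rewrite /n floor_derivE bformD; apply: eq_bform => k _; rewrite /c1 subrK.
have M0 : 0 <= M by apply: le_trans (c1M 0%N _).
have nM : n%:R * M = n%:R * D + 2 ^+ s * K * (1 + 2 * (n%:R * D) + A * s%:R).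
  by rewrite /M /W; field; rewrite gt_eqF.
have NnM : N%:R * M <= n%:R * M by rewrite ler_wpM2r// ler_nat leq_addr.
have KD : 0 <= 2 ^+ s * K by rewrite mulr_ge0 ?exprn_ge0.
have nD : 0 <= n%:R * D by rewrite mulr_ge0.
have KDn : 0 <= (2 ^+ s * K) * (n%:R * D) by rewrite mulr_ge0.
have KA : 0 <= (2 ^+ s * K) * A by rewrite mulr_ge0.
have KAs : 0 <= (2 ^+ s * K) * A * s%:R by rewrite mulr_ge0.
have Ks : 0 <= (2 ^+ s * K) * s%:R by rewrite mulr_ge0.
have KDs : 0 <= (2 ^+ s * K) * s%:R * (n%:R * D) by rewrite mulr_ge0.
have NM0 : 0 <= N%:R * M by rewrite mulr_ge0.
have fin X Y : X <= 4 * N%:R * M -> Y <= 2 * A ->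
   X + Y <= (6 + 8 * (2 ^+ s * K) + 4 * (2 ^+ s * K) * s%:R) * (n%:R * D + A + 1).
  move=> hX hY.
  have : X + Y <= 4 * (n%:R * M) + 2 * A by lra.
  by move=> /le_trans; apply; rewrite nM; lra.
move=> z z01; rewrite dE; split.
- rewrite derivD hornerD (le_trans (ler_normD _ _))// fin//.
    by apply: le_trans (deriv_bform_bound N c1 M z z01 c1M) _; lra.
  apply: (le_trans (_ : _ <= A)); last by lra.
  apply: deriv_bform_poly_bound => // y y01.
  by rewrite derivnS; exact: (gA y y01).1.
- rewrite derivnD hornerD mulrDr (le_trans (ler_normD _ _))// fin//.
    exact: phi2_deriv2_bform_bound.
  apply: phi2_bform_poly_bound => // y y01.
  by rewrite !derivnS; exact: (gA y y01).2.
Qed.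

(* Berens-Lorentz iteration along n_j = n2 B^j, with B^(1 - al) beating the
   constant of [converse_step]. *)
Lemma converse_iterate s f al C0 K n1 : (0 < s)%N -> C01 s f -> 0 < al < 1 ->
  0 <= K -> coef_error_bound s f K n1 ->
  (forall n, (n1 <= n)%N -> forall x, 0 <= x <= 1 ->
     `|(floor_deriv s f n).[x] - derive01n s f x| <= C0 * n%:R `^ (- al)) ->
  exists B n2 A, [/\ (1 < B)%N, (0 < n2)%N, (n1 <= n2)%N & forall j,
     smooth_bound (floor_deriv s f (n2 * B ^ j)) (A * (n2 * B ^ j)%:R `^ (1 - al))].
Proof.
move=> s0 fC /andP[al0 al1] K0 HK rate.
have [C C1 step] := converse_step s f K n1 s0 fC K0 HK.
pose n2 := (n1 + s + 1)%N.
have n20 : (0 < n2)%N by rewrite /n2 addn1.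
have n12 : (n1 + s < n2)%N by rewrite /n2 addn1.
have C00 : 0 <= C0.
  have h := rate n2 _ 0 _; have n1n2 : (n1 <= n2)%N by rewrite /n2 -addnA leq_addr.
  have p0 : 0 < n2%:R `^ (- al) :> R by rewrite powR_gt0// ltr0n.
  rewrite -(pmulr_lge0 _ p0); apply: le_trans (h n1n2 _) => //.
  by rewrite lexx ler01.
pose B := (Num.truncn ((2 * C + 2) `^ (1 - al)^-1)).+1.
have BR : 2 * C + 2 <= B%:R `^ (1 - al).
  have e : ((2 * C + 2) `^ (1 - al)^-1) `^ (1 - al) = 2 * C + 2.
    by rewrite -powRrM mulVf ?powRr1//; lra.
  rewrite -{1}e; apply: ge0_ler_powR; rewrite ?nnegrE ?powR_ge0//; first by lra.
  by apply: ltW; exact: truncnS_gt.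
have B1 : (1 < B)%N.
  rewrite ltnNge; apply/negP => B1.
  have : B%:R `^ (1 - al) <= 1 :> R.
    by apply: powR_le1; [lra|rewrite ler0n (ler_nat _ _ 1)].
  lra.
have [A0 hA0] : exists A, smooth_bound (floor_deriv s f n2) A.
  have -> : n2 = ((n1 + 1) + s)%N by rewrite /n2; clear; lia.
  by rewrite floor_derivE; exact: smooth_bound_exists.
(* [A0] starts the induction and C0 B + 1 makes the inhomogeneous terms at most A q. As B is fixed
   before A, the choice is not circular. *)
pose A := Num.max (C0 * B%:R + 1) A0.
have A1 : C0 * B%:R + 1 <= A by rewrite le_max lexx.
have A2 : A0 <= A by rewrite le_max lexx orbT.
exists B, n2, A; split=> //; first by rewrite /n2 -addnA leq_addr.
have nj0 j : (0 < n2 * B ^ j)%N by rewrite muln_gt0 n20 expn_gt0 (ltnW B1).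
have q1 m : (0 < m)%N -> 1 <= m%:R `^ (1 - al).
  by move=> m0; apply: powR_ge1; [lra|rewrite ler1n].
have Age0 : 0 <= A.
  by apply: le_trans A1; rewrite addr_ge0// mulr_ge0.
elim => [|j ih].
  move=> z /hA0[h1 h2]; rewrite expn0 muln1.
  suff h : A0 <= A * n2%:R `^ (1 - al) by split; apply: le_trans h.
  by apply: le_trans A2 _; rewrite ler_peMr// q1.
set m := (n2 * B ^ j)%N in ih *.
have -> : (n2 * B ^ j.+1)%N = (m * B)%N by rewrite /m expnSr mulnA.
have mR : 0 < m%:R :> R by rewrite ltr0n nj0.
have BR0 : 0 < B%:R :> R by rewrite ltr0n ltnW.
have n2m : (n2 <= m)%N by rewrite leq_pmulr// expn_gt0 (ltnW B1).
have mmB : (m <= m * B)%N by rewrite leq_pmulr// ltnW.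
have n1m : (n1 <= m)%N by apply: leq_trans n2m; rewrite /n2 -addnA leq_addr.
have := step (m * B)%N (bform m (floor_coef m f)) (C0 * m%:R `^ (- al)) _ _ _ ih.
move=> /(_ (leq_trans n12 (leq_trans n2m mmB)) (rate m n1m)) h z /h[h1 h2].
suff H : C * ((m * B)%:R * (C0 * m%:R `^ (- al)) + A * m%:R `^ (1 - al) + 1) <=
    A * (m * B)%:R `^ (1 - al) by split; apply: le_trans H.
rewrite natrM powRM ?ler0n//.
have -> : m%:R `^ (- al) = m%:R `^ (1 - al) / m%:R.
  rewrite [in LHS](_ : - al = (1 - al) + (-1)); last by ring.
  by rewrite powRD ?(gt_eqF mR) ?implybT// powR_inv1// ler0n.
have := q1 m (nj0 j); set q := m%:R `^ (1 - al) => qge1.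
have -> : m%:R * B%:R * (C0 * (q / m%:R)) = C0 * B%:R * q by field; rewrite gt_eqF.
apply: (le_trans (_ : _ <= A * (q * (2 * C + 2)))); last first.
  by rewrite ler_wpM2l// ler_wpM2l//; lra.
have Cge0 : 0 <= C by lra.
have h3 : C0 * B%:R * q + 1 <= A * q.
  have : (C0 * B%:R + 1) * q <= A * q by rewrite ler_wpM2r//; lra.
  lra.
have h4 : C * (C0 * B%:R * q + A * q + 1) <= C * (2 * (A * q)) by rewrite ler_wpM2l//; lra.
have : 0 <= A * q by rewrite mulr_ge0//; lra.
lra.
Qed.

Lemma converse_approx s f al C0 K n1 : (0 < s)%N -> C01 s f -> 0 < al < 1 ->
  0 <= K -> coef_error_bound s f K n1 ->
  (forall n, (n1 <= n)%N -> forall x, 0 <= x <= 1 ->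
     `|(floor_deriv s f n).[x] - derive01n s f x| <= C0 * n%:R `^ (- al)) ->
  exists C t0, 0 < t0 /\ forall t, 0 < t < t0 -> exists p,
     (forall z, 0 <= z <= 1 -> `|p.[z] - derive01n s f z| <= C * t `^ al) /\
     smooth_bound p (C * t `^ (al - 1)).
Proof.
move=> s0 fC al01 K0 HK rate.
have [B [n2 [A [B1 n20 n12 H]]]] := converse_iterate s f al C0 K n1 s0 fC al01 K0 HK rate.
have BR0 : 0 < B%:R :> R by rewrite ltr0n ltnW.
have n2R : 0 < n2%:R :> R by rewrite ltr0n.
have z0 : 0 <= (0 : R) <= 1 by rewrite lexx ler01.
have C00 : 0 <= C0.
  have p0 : 0 < n2%:R `^ (- al) :> R by rewrite powR_gt0// ltr0n.
  by rewrite -(pmulr_lge0 _ p0); apply: le_trans (rate n2 n12 0 z0).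
have A0 : 0 <= A.
  have p0 : 0 < (n2 * B ^ 0)%:R `^ (1 - al) :> R by rewrite powR_gt0// ltr0n muln1.
  by rewrite -(pmulr_lge0 _ p0); apply: le_trans (H 0%N 0 z0).1.
exists (C0 * B%:R + A), n2%:R^-1; split; first by rewrite invr_gt0.
move=> t /andP[t0 tn2].
have n2t : n2%:R < t^-1 by rewrite -[X in X < _]invrK ltf_pV2 ?posrE ?invr_gt0.
have ex : exists j, t^-1 < (n2 * B ^ j)%:R.
  have [j hj] : exists j : nat, t^-1 < j%:R by exists (Num.truncn t^-1).+1; exact: truncnS_gt.
  exists j; apply: lt_le_trans hj _; rewrite ler_nat.
  by apply: leq_trans (ltnW (ltn_expl j B1)) _; rewrite leq_pmull.
(* The first index beyond 1/t is not 0, as t < 1/n2; its predecessor gives m <= 1/t < B m, so powers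
   of m and of 1/t are comparable. *)
case: (ex_minnP ex) => -[|j] hj jmin.
  by move: hj; rewrite expn0 muln1 => /lt_trans/(_ n2t); rewrite ltxx.
have mt : (n2 * B ^ j)%:R <= t^-1.
  by rewrite leNgt; apply/negP => /jmin; rewrite ltnn.
set m := (n2 * B ^ j)%N in mt.
have m0 : (0 < m)%N by rewrite muln_gt0 n20 expn_gt0 (ltnW B1).
have n1m : (n1 <= m)%N.
  by apply: leq_trans n12 _; rewrite leq_pmulr// expn_gt0 (ltnW B1).
have mR : 0 < m%:R :> R by rewrite ltr0n.
have tm : m%:R^-1 <= B%:R * t.
  move: hj; rewrite expnSr mulnA -/m natrM => /ltW hj.
  rewrite -[X in X <= _]mul1r ler_pdivrMr//.
  by have := ler_wpM2l (ltW t0) hj; rewrite mulfV ?gt_eqF//; lra.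
have /andP[al0 al1] := al01.
exists (floor_deriv s f m); split.
  move=> z z01; apply: le_trans (rate m n1m z z01) _.
  rewrite (powRNV _ _ (ltW mR)) mulrDl ler_wpDr ?mulr_ge0 ?powR_ge0//.
  rewrite -mulrA ler_wpM2l//.
  apply: le_trans (powR_scale al B t _ (ltnW B1) (ltW t0)); last by lra.
  by apply: ge0_ler_powR; rewrite ?nnegrE ?invr_ge0 ?mulr_ge0//; exact: ltW.
have q : A * m%:R `^ (1 - al) <= (C0 * B%:R + A) * t `^ (al - 1).
  apply: (le_trans (_ : _ <= A * t `^ (al - 1))).
    rewrite ler_wpM2l// -[al - 1]opprB (powRNV _ _ (ltW t0)).
    by apply: ge0_ler_powR; rewrite ?nnegrE ?invr_ge0 ?subr_ge0//; exact: ltW.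
  by rewrite ler_wpM2r ?powR_ge0// lerDr mulr_ge0// ltW.
by move=> z z01; have [h1 h2] := H j z z01; split; apply: le_trans q.
Qed.

End Rates.

(** * Moduli of smoothness *)

Section Moduli.
Context {R : realType}.
Implicit Types (f F : R -> R) (x y t h al B C : R) (s n k : nat) (p : {poly R}).

Lemma norm01_ub F B x : (forall y, 0 <= y <= 1 -> `|F y| <= B) -> 0 <= x <= 1 ->
  `|F x| <= norm01 F.
Proof.
move=> FB x01; apply: ub_le_sup; last by exists x; rewrite //= in_itv.
by exists B => _ [y /= y01 <-]; apply: FB; rewrite in_itv in y01.
Qed.

Lemma norm01_le F B : (forall y, 0 <= y <= 1 -> `|F y| <= B) -> norm01 F <= B.
Proof.
move=> FB; apply: ge_sup; first by exists `|F 0|, 0; rewrite //= in_itv /= lexx ler01.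
by move=> _ [y /= y01 <-]; apply: FB; rewrite in_itv in y01.
Qed.

Lemma omega1_ub F B h x y : (forall z, 0 <= z <= 1 -> `|F z| <= B) ->
  0 <= x <= 1 -> 0 <= y <= 1 -> `|x - y| <= h -> `|F x - F y| <= omega1 F h.
Proof.
move=> FB x01 y01 xy; apply: ub_le_sup.
  exists (B + B) => _ [[a b] [/= a01 b01 _] <-]; rewrite !in_itv /= in a01 b01.
  by rewrite (le_trans (ler_normB _ _))// lerD// FB.
by exists (x, y) => //=; split=> //; rewrite in_itv.
Qed.

Lemma omega1_le F B h : 0 <= h -> (forall x y, 0 <= x <= 1 -> 0 <= y <= 1 ->
  `|x - y| <= h -> `|F x - F y| <= B) -> `|omega1 F h| <= B.
Proof.
move=> h0 FB; have z0 : 0 <= (0 : R) <= 1 by rewrite lexx ler01.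
rewrite ger0_norm.
  apply: ge_sup; last first.
    by move=> _ [[x y] [/= x01 y01 xy] <-]; apply: FB => //; rewrite !in_itv in x01 y01.
  exists `|F 0 - F 0|, (0, 0) => //=.
  by split; rewrite ?in_itv /= ?lexx ?ler01// subrr normr0.
apply: le_trans (normr_ge0 (F 0 - F 0)) _; apply: ub_le_sup; last first.
  by exists (0, 0) => //=; split; rewrite ?in_itv /= ?lexx ?ler01// subrr normr0.
by exists B => _ [[x y] [/= x01 y01 xy] <-]; apply: FB.
Qed.

Lemma symdiff2_bound F B u x : (forall z, 0 <= z <= 1 -> `|F z| <= B) -> 0 <= x <= 1 ->
  `|symdiff2 F u x| <= 4 * B.
Proof.
move=> FB x01; have B0 : 0 <= B by apply: le_trans (FB x x01).
rewrite /symdiff2 !in_itv /=; case: ifP => [/andP[xu1 xu2]|_]; last first.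
  by rewrite normr0 mulr_ge0.
have := FB _ xu1; have := FB _ xu2; have := FB _ x01.
have := ler_normD (F (x + u) - 2 * F x) (F (x - u)).
have := ler_normB (F (x + u)) (2 * F x).
by rewrite normrM (ger0_norm (ler0n R 2)); lra.
Qed.

Lemma omega2phi_ub F B h x : (forall z, 0 <= z <= 1 -> `|F z| <= B) ->
  0 < h -> 0 <= x <= 1 -> `|symdiff2 F (h * phi x) x| <= omega2phi F h.
Proof.
move=> FB h0 x01.
apply: (@le_trans _ _ (norm01 (fun x => symdiff2 F (h * phi x) x))).
  apply: (norm01_ub (fun x => symdiff2 F (h * phi x) x) (4 * B)) => // y y01.
  exact: symdiff2_bound.
apply: ub_le_sup; last by exists h; rewrite //= in_itv /= h0 lexx.
exists (4 * B) => _ [g _ <-]; apply: norm01_le => y y01.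
exact: symdiff2_bound.
Qed.

Lemma omega2phi_le F B h : 0 < h -> (forall g x, 0 < g <= h -> 0 <= x <= 1 ->
  `|symdiff2 F (g * phi x) x| <= B) -> `|omega2phi F h| <= B.
Proof.
move=> h0 FB.
have H g : 0 < g <= h -> norm01 (fun x => symdiff2 F (g * phi x) x) <= B.
  by move=> gh; apply: norm01_le => y y01; exact: FB.
rewrite ger0_norm.
  apply: ge_sup; last by move=> _ [g /= gh <-]; apply: H; rewrite in_itv in gh.
  by exists (norm01 (fun x => symdiff2 F (h * phi x) x)), h; rewrite //= in_itv /= h0 lexx.
apply: (@le_trans _ _ (norm01 (fun x => symdiff2 F (h * phi x) x))).
  apply: le_trans (normr_ge0 (symdiff2 F (h * phi 0) 0)) _.
  apply: (norm01_ub (fun x => symdiff2 F (h * phi x) x) B); last by rewrite lexx ler01.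
  by move=> y y01; apply: FB => //; rewrite h0 lexx.
apply: ub_le_sup; last by exists h; rewrite //= in_itv /= h0 lexx.
by exists B => _ [g /= gh <-]; apply: H; rewrite in_itv in gh.
Qed.

Lemma powR_2M h al : 0 <= h -> h `^ (2 * al) = (h ^+ 2) `^ al.
Proof. by move=> h0; rewrite powRrM powR_mulrn. Qed.

(** The O-bound only concerns distances below some d; beyond d, boundedness of F suffices at the
    price of a factor d^-al. *)
Lemma omega1_holder F B al : 0 < al -> (forall z, 0 <= z <= 1 -> `|F z| <= B) ->
  omega1 F =O_ (0^'+) (fun h : R => h `^ al) ->
  exists2 C, 0 <= C & forall x y, 0 <= x <= 1 -> 0 <= y <= 1 ->
    `|F x - F y| <= C * `|x - y| `^ al.
Proof.
move=> al0 FB /eqO_exP[C C0]; rewrite /at_right near_withinE => /nbhs_normP[d /= d0 dP].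
have B0 : 0 <= B by apply: le_trans (FB 0 _); rewrite // lexx ler01.
have da0 : 0 < d `^ al by rewrite powR_gt0.
have K1 : 0 <= C by exact: ltW.
have K2 : 0 <= 2 * B / d `^ al by rewrite divr_ge0 ?mulr_ge0 ?powR_ge0.
exists (C + 2 * B / d `^ al) => [|x y x01 y01]; first exact: addr_ge0.
have [->|xy] := eqVneq x y.
  by rewrite subrr normr0 mulr_ge0 ?powR_ge0// addr_ge0.
have xy0 : 0 < `|x - y| by rewrite normr_gt0 subr_eq0.
have pa0 : 0 <= `|x - y| `^ al by exact: powR_ge0.
rewrite mulrDl; have [xyd|dxy] := ltP `|x - y| d.
  rewrite ler_wpDr//; first exact: mulr_ge0.
  apply: le_trans (omega1_ub F B _ x y FB x01 y01 (lexx _)) _.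
  have := dP `|x - y|; rewrite /= sub0r normrN normr_id => /(_ xyd xy0).
  by rewrite (ger0_norm pa0); apply: le_trans; exact: ler_norm.
rewrite ler_wpDl//; first exact: mulr_ge0.
apply: (@le_trans _ _ (2 * B)).
  by have := ler_normB (F x) (F y); have := FB x x01; have := FB y y01; lra.
have q1 : 1 <= `|x - y| `^ al / d `^ al.
  rewrite ler_pdivlMr// mul1r.
  by apply: ge0_ler_powR; rewrite ?nnegrE//; exact: ltW.
by have := ler_wpM2l (mulr_ge0 (ler0n R 2) B0) q1; lra.
Qed.

(** The squared scale v replaces h^2, which keeps square roots out of the estimates: u^2 <= v y(1-y)
    says that h = u / phi(y) has h^2 <= v. *)
Lemma omega2phi_symdiff2 F B al : 0 < al -> (forall z, 0 <= z <= 1 -> `|F z| <= B) ->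
  omega2phi F =O_ (0^'+) (fun h : R => h `^ (2 * al)) ->
  exists2 C, 0 <= C & forall y u v : R, 0 <= v -> 0 <= u -> 0 <= y - u -> y + u <= 1 ->
     u ^+ 2 <= v * (y * (1 - y)) ->
     `|F (y + u) - 2 * F y + F (y - u)| <= C * v `^ al.
Proof.
move=> al0 FB /eqO_exP[C C0]; rewrite /at_right near_withinE => /nbhs_normP[d /= d0 dP].
have B0 : 0 <= B by apply: le_trans (FB 0 _); rewrite // lexx ler01.
have da0 : 0 < d `^ (2 * al) by rewrite powR_gt0.
have K1 : 0 <= C by exact: ltW.
have K2 : 0 <= 4 * B / d `^ (2 * al) by rewrite divr_ge0 ?mulr_ge0 ?powR_ge0.
have K0 : 0 <= C + 4 * B / d `^ (2 * al) by exact: addr_ge0.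
exists (C + 4 * B / d `^ (2 * al)) => // y u v v0 u0 yu uy uv.
have [ue0|un0] := eqVneq u 0.
  rewrite ue0 addr0 subr0 [X in `|X|](_ : _ = 0); last by ring.
  by rewrite normr0 mulr_ge0// powR_ge0.
have up : 0 < u by rewrite lt_neqAle eq_sym un0.
have p0 : 0 < y * (1 - y) by rewrite mulr_gt0; lra.
have phi0 : 0 < phi y by rewrite sqrtr_gt0.
have phi2 : phi y ^+ 2 = y * (1 - y) by rewrite sqr_sqrtr// ltW.
pose h := u / phi y.
have h0 : 0 < h by rewrite divr_gt0.
have hu : h * phi y = u by rewrite divfK// gt_eqF.
have hv : h ^+ 2 <= v by rewrite expr_div_n phi2 ler_pdivrMr.
have hva : h `^ (2 * al) <= v `^ al.
  rewrite powR_2M ?(ltW h0)//.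
  by apply: ge0_ler_powR; rewrite ?nnegrE ?exprn_ge0//; exact: ltW.
have y01 : 0 <= y <= 1 by lra.
have e : F (y + u) - 2 * F y + F (y - u) = symdiff2 F (h * phi y) y.
  rewrite hu /symdiff2 !in_itv /= ifT//; apply/andP; split; lra.
rewrite e; apply: le_trans (ler_wpM2l K0 hva).
have pa0 : 0 <= h `^ (2 * al) by exact: powR_ge0.
rewrite mulrDl; have [hd|dh] := ltP h d.
  rewrite ler_wpDr//; first exact: mulr_ge0.
  apply: le_trans (omega2phi_ub F B h y FB h0 y01) _.
  have := dP h; rewrite /= sub0r normrN (gtr0_norm h0) => /(_ hd h0).
  by rewrite (ger0_norm pa0); apply: le_trans; exact: ler_norm.
rewrite ler_wpDl//; first exact: mulr_ge0.
apply: le_trans (symdiff2_bound F B _ y FB y01) _.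
have q1 : 1 <= h `^ (2 * al) / d `^ (2 * al).
  rewrite ler_pdivlMr// mul1r.
  by apply: ge0_ler_powR; rewrite ?nnegrE//; [lra|exact: ltW..].
by have := ler_wpM2l (mulr_ge0 (ler0n R 4) B0) q1; lra.
Qed.

(** A K-functional estimate: error plus t times smoothness is O(t^al). The sign of C is left open,
    hence |C| in the constants below. *)
Definition smooth_approx F al C t0 := forall t, 0 < t < t0 -> exists p,
  (forall z, 0 <= z <= 1 -> `|p.[z] - F z| <= C * t `^ al) /\
  smooth_bound p (C * t `^ (al - 1)).

Lemma smooth_approx_omega1 F al C t0 : 0 < t0 -> smooth_approx F al C t0 ->
  omega1 F =O_ (0^'+) (fun h : R => h `^ al).
Proof.
move=> t00 FA; apply/eqO_exP.
exists (3 * `|C| + 1); first by rewrite ltr_wpDl// mulr_ge0.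
rewrite /at_right near_withinE; apply/nbhs_normP; exists t0 => //= h.
rewrite /= sub0r normrN => ht0 h0; rewrite (gtr0_norm h0) in ht0.
have [|p [pF pA]] := FA h; first by rewrite h0 ht0.
rewrite (ger0_norm (powR_ge0 _ _)).
have q0 : 0 <= h `^ al by exact: powR_ge0.
have Cq : C * h `^ al <= `|C| * h `^ al by rewrite ler_wpM2r// ler_norm.
apply: omega1_le => [|x y x01 y01 xy]; first exact: ltW.
have h1 := pF x x01; have h2 := pF y y01; rewrite distrC in h1.
have h3 := smooth_bound_lipschitz _ _ x y pA x01 y01.
have h4 : C * h `^ (al - 1) * `|x - y| <= `|C| * h `^ al.
  rewrite (_ : `|C| * h `^ al = `|C| * h `^ (al - 1) * h).
    by apply: ler_pM => //; rewrite ?ler_wpM2r ?powR_ge0 ?ler_norm//;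
      exact: le_trans (normr_ge0 _) (pA 0 ltac:(lra)).1.
  rewrite -mulrA; congr (_ * _).
  by rewrite -{3}(powRr1 (ltW h0)) -powRD ?subrK// (gt_eqF h0) implybT.
rewrite (_ : F x - F y = (F x - p.[x]) + (p.[x] - p.[y]) + (p.[y] - F y)); last by ring.
apply: le_trans (ler_normD _ _) _.
apply: le_trans (lerD (ler_normD _ _) (lexx _)) _.
lra.
Qed.

Lemma smooth_approx_omega2phi F al C t0 : 0 < t0 -> smooth_approx F al C t0 ->
  omega2phi F =O_ (0^'+) (fun h : R => h `^ (2 * al)).
Proof.
move=> t00 FA; apply/eqO_exP.
(* Replacing F by p in the second difference costs 1 + 2 + 1, and the difference of p costs 2. *)
exists (6 * `|C| + 1); first by rewrite ltr_wpDl// mulr_ge0.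
(* The bound 1 ensures h^2 <= h < t0, so that t = h^2 is admissible. *)
rewrite /at_right near_withinE; apply/nbhs_normP; exists (Num.min t0 1) => /=.
  by rewrite lt_min t00 ltr01.
move=> h; rewrite /= sub0r normrN => + h0; rewrite (gtr0_norm h0) lt_min => /andP[ht0 h1].
have h20 : 0 < h ^+ 2 by rewrite exprn_gt0.
have h2t : h ^+ 2 < t0 by apply: le_lt_trans ht0; rewrite expr2 ler_piMl// ltW.
have [|p [pF pA]] := FA (h ^+ 2); first by rewrite h20 h2t.
rewrite (ger0_norm (powR_ge0 _ _)) powR_2M ?(ltW h0)//.
set t := h ^+ 2 in h20 h2t pF pA *.
have q0 : 0 <= t `^ al by exact: powR_ge0.
have Cq : C * t `^ al <= `|C| * t `^ al by rewrite ler_wpM2r// ler_norm.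
have Cq0 : 0 <= `|C| * t `^ al by rewrite mulr_ge0.
apply: omega2phi_le => // g x /andP[g0 gh] x01.
rewrite /symdiff2 !in_itv /=; case: ifP => [/andP[xu1 xu2]|_]; last first.
  by rewrite normr0 mulr_ge0// addr_ge0// mulr_ge0.
have pp0 : 0 <= x * (1 - x) by case/andP: x01 => ? ?; rewrite mulr_ge0// subr_ge0.
have phi2 : phi x ^+ 2 = x * (1 - x) by rewrite sqr_sqrtr.
set u := g * phi x in xu1 xu2 *.
have u0 : 0 <= u by rewrite mulr_ge0 ?sqrtr_ge0//; exact: ltW.
have u2 : u ^+ 2 = g ^+ 2 * (x * (1 - x)) by rewrite exprMn phi2.
have Dp : `|p.[x + u] - 2 * p.[x] + p.[x - u]| <= 2 * (`|C| * t `^ al).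
  have [pz|pz] := eqVneq (x * (1 - x)) 0.
    have ue0 : u = 0 by apply/eqP; rewrite -sqrf_eq0 u2 pz mulr0.
    rewrite ue0 addr0 subr0 [X in `|X|](_ : _ = 0); last by ring.
    by rewrite normr0 mulr_ge0.
  have pp : 0 < x * (1 - x) by rewrite lt_neqAle eq_sym pz.
  have := symdiff2_poly p _ x u (fun z z01 => (pA z z01).2) u0 _ _.
  move=> /(_ ltac:(lra) ltac:(lra)).
  rewrite u2 [X in _ <= X](_ : _ = x * (1 - x) * (2 * (C * t `^ (al - 1)) * g ^+ 2));
    last by ring.
  rewrite ler_pM2l// => /le_trans; apply.
  rewrite -mulrA ler_wpM2l//.
  rewrite (_ : t `^ al = t `^ (al - 1) * t).
    have g2t : 0 <= g ^+ 2 <= t.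
      by rewrite exprn_ge0 ?(ltW g0)//= /t ler_sqr ?nnegrE//; exact: ltW.
    move: (g ^+ 2) g2t => g2 /andP[g20 g2t]; rewrite mulrA; apply: ler_pM => //.
      exact: le_trans (normr_ge0 _) (pA 0 ltac:(lra)).1.
    by rewrite ler_wpM2r ?powR_ge0// ler_norm.
  by rewrite -{3}(powRr1 (ltW h20)) -powRD ?subrK// (gt_eqF h20) implybT.
have a1 := pF _ xu1; have a2 := pF _ xu2; have a3 := pF _ x01.
rewrite (_ : F (x + u) - 2 * F x + F (x - u) =
  (p.[x + u] - 2 * p.[x] + p.[x - u]) - ((p.[x + u] - F (x + u)) +
    (p.[x - u] - F (x - u)) - 2 * (p.[x] - F x))); last by ring.
apply: le_trans (ler_normB _ _) _.
have := ler_normB ((p.[x + u] - F (x + u)) + (p.[x - u] - F (x - u))) (2 * (p.[x] - F x)).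
have := ler_normD (p.[x + u] - F (x + u)) (p.[x - u] - F (x - u)).
rewrite (normrM 2) (ger0_norm (ler0n R 2)); lra.
Qed.

Lemma within01_bounded F : {within `[0, 1], continuous F} ->
  exists B, forall z, 0 <= z <= 1 -> `|F z| <= B.
Proof.
move=> cF.
have [c _ cM] := EVT_max ler01 cF; have [d _ dM] := EVT_min ler01 cF.
exists (`|F c| + `|F d|) => z z01.
have := cM z; have := dM z; rewrite in_itv /= => /(_ z01) h1 /(_ z01) h2.
have := ler_norm (F c); have := ler_norm (- F d); rewrite normrN => h3 h4.
by rewrite ler_norml; apply/andP; split; have := normr_ge0 (F c); have := normr_ge0 (F d); lra.
Qed.

Lemma norm01_floor_deriv s n f :
  norm01 (fun x => derive01n s (intBernstein n f) x - derive01n s f x) =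
  norm01 (fun x => (floor_deriv s f n).[x] - derive01n s f x).
Proof.
congr sup; apply: eq_imagel => x /=; rewrite in_itv /= => x01.
rewrite (_ : intBernstein n f = horner (bform n (floor_coef n f))).
  by rewrite derive01n_horner.
by apply/funext => y; exact: intBernstein_bform.
Qed.

End Moduli.

Theorem corollary1p2 (R : realType) (s : nat) (alpha : R) (f : R -> R)
  (s_gt0 : (0 < s)%N) (alpha_gt0 : 0 < alpha) (alpha_lt1 : alpha < 1)
  (f_Cs : C01 s f)
  (f0_int : f 0 \is a Num.int) (f1_int : f 1 \is a Num.int)
  (df0_int : derive01n 1 f 0 \is a Num.int)
  (df1_int : derive01n 1 f 1 \is a Num.int)
  (df_eq0 : forall i : nat, (2 <= i <= s)%N ->
     derive01n i f 0 = 0 /\ derive01n i f 1 = 0)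
  (f_ge : exists n0 : nat, [/\ (0 < n0)%N, (s <= n0)%N,
     forall n k : nat, (n0 <= n)%N -> (1 <= k <= s)%N ->
       f (k%:R / n%:R) >= f 0 + k%:R / n%:R * derive01n 1 f 0
   & forall n k : nat, (n0 <= n)%N -> (n - s <= k <= n - 1)%N ->
       f (k%:R / n%:R) >= f 1 - (1 - k%:R / n%:R) * derive01n 1 f 1]) :
  (fun n : nat =>
     norm01 (fun x => derive01n s (intBernstein n f) x - derive01n s f x))
    =O_\oo (fun n : nat => n%:R `^ (- alpha))
  <->
  ((fun h : R => omega2phi (derive01n s f) h)
     =O_ (0^'+) (fun h : R => h `^ (2 * alpha)) /\
   (fun h : R => omega1 (derive01n s f) h)
     =O_ (0^'+) (fun h : R => h `^ alpha)).
Proof.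
have [K [n1 [K0 _ HK]]] :=
  floor_coef_dist s f s_gt0 f_Cs f0_int f1_int df0_int df1_int df_eq0 f_ge.
have [B FB] := within01_bounded _ f_Cs.2.
split.
- move=> /eqO_exP[C C0 [n2 _ n2P]].
  have HK' : coef_error_bound s f K (n1 + n2).
    by move=> n W nn; apply: HK; exact: leq_trans (leq_addr _ _) nn.
  have rate n : (n1 + n2 <= n)%N -> forall x, 0 <= x <= 1 ->
      `|(floor_deriv s f n).[x] - derive01n s f x| <= C * n%:R `^ (- alpha).
    move=> nn x x01; have := n2P n (leq_trans (leq_addl _ _) nn).
    rewrite /= norm01_floor_deriv [ `|_ `^ _|]ger0_norm ?powR_ge0//.
    apply: le_trans; apply: le_trans (ler_norm _).
    (* [norm01] bounds values only if the set under its supremum is bounded; otherwise it is a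
       default value. *)
    have [A pA] : exists A, forall z, 0 <= z <= 1 -> `|(floor_deriv s f n).[z]| <= A.
      by apply: within01_bounded; apply: continuous_subspaceT; exact: continuous_horner.
    apply: (norm01_ub (fun x => (floor_deriv s f n).[x] - derive01n s f x) (A + B)) => //.
    move=> y y01; apply: le_trans (ler_normB _ _) _.
    by apply: lerD; [exact: pA|exact: FB].
  have al01 : 0 < alpha < 1 by rewrite alpha_gt0.
  have [C' [t0 [t00 FA]]] := converse_approx s f alpha C K _ s_gt0 f_Cs al01 K0 HK' rate.
  split; first exact: smooth_approx_omega2phi t00 FA.
  exact: smooth_approx_omega1 t00 FA.
- move=> [w2 w1].
  have [C1 C10 hF] := omega1_holder _ B alpha alpha_gt0 FB w1.
  have [C2 C20 zF] := omega2phi_symdiff2 _ B alpha alpha_gt0 FB w2.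
  have al01 : 0 <= alpha <= 1 by rewrite !ltW.
  have [|x y x01 y01|y u v v0 u0 yu uy uv|K' rate] :=
    direct_rate s f alpha (C1 + C2) K n1 s_gt0 f_Cs al01 _ K0 HK.
  + exact: addr_ge0.
  + by apply: le_trans (hF x y x01 y01) _; rewrite ler_wpM2r ?powR_ge0// lerDl.
  + apply: le_trans (zF y u v v0 u0 yu uy uv) _.
    by rewrite ler_wpM2r ?powR_ge0// lerDr.
  apply/eqO_exP; exists (`|K'| + 1); first by rewrite ltr_wpDl.
  exists (n1 + 2 * s)%N => // n /= nn.
  rewrite norm01_floor_deriv [ `|_ `^ _|]ger0_norm ?powR_ge0//.
  have bd x : 0 <= x <= 1 ->
      `|(floor_deriv s f n).[x] - derive01n s f x| <= (`|K'| + 1) * n%:R `^ (- alpha).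
    move=> x01; apply: le_trans (rate n nn x x01) _.
    by rewrite ler_wpM2r ?powR_ge0// (le_trans (ler_norm _))// lerDl.
  rewrite ger0_norm; first exact: norm01_le.
  have z0 : 0 <= (0 : R) <= 1 by rewrite lexx ler01.
  by apply: le_trans (norm01_ub (fun x => (floor_deriv s f n).[x] - derive01n s f x) _ 0 bd z0).
Qed.
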